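(* Let $A: C^\infty(S^1)\to C^\infty(S^1)$ be a linear differential operator with constant real coefficients which is symmetric for the $L^2$ inner product and is a continuous linear isomorphism of $C^\infty(S^1)$, and let $X_A(m)=2mu_x+um_x$, $u=A^{-1}m$, be its Euler vector field. If $X_A$ is bi-Hamiltonian relatively to some modified Lie-Poisson structure, i.e. if there is a local $2$-cocycle operator $Q$ (see context) and a regular function $F$ on $C^\infty(S^1)$ with $X_A(m)=Q\,\delta F(m)$ for all $m$, then $$A=aI+bD^2$$ for some $a,b\in\mathbb{R}$ satisfying $a-bn^2\neq 0$ for all $n\in\mathbb{Z}$. Conversely, for every $a,b\in\mathbb{R}$ with $a-bn^2\ne 0$ for all $n\in\mathbb{Z}$, the operator $A=aI+bD^2$ is such an invertible operator, and $X_A$ is bi-Hamiltonian: the operator $Q=DA=aD+bD^3$ is a local $2$-cocycle operator and $$X_A(m)=Q\,\delta H_3(m)\quad\text{for all } m\in C^\infty(S^1),\qquad H_3(m)=\frac12\int_{S^1}\big(au^3-bu(u_x)^2\big)\,dx,\quad m=Au .$$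
   Context: $S^1=\mathbb{R}/2\pi\mathbb{Z}$; $C^\infty(S^1)$ is the Fréchet space of smooth real $2\pi$-periodic functions; $D=d/dx$; subscript $x$ denotes the $x$-derivative. $\mathrm{Vect}(S^1)\cong C^\infty(S^1)$ is the Lie algebra with bracket $[u,v]=uv_x-u_xv$. Its regular dual $\mathrm{Vect}^*(S^1)$ is identified with $C^\infty(S^1)$ through the pairing $\langle m,u\rangle=\int_{S^1}mu\,dx$. A smooth function $F:C^\infty(S^1)\to\mathbb{R}$ is called regular if there is a smooth map $\delta F:C^\infty(S^1)\to C^\infty(S^1)$ (the $L^2$ gradient) such that $dF(m)M=\int_{S^1}M\,\delta F(m)\,dx$ for all $m,M\in C^\infty(S^1)$. The canonical Lie-Poisson structure on $\mathrm{Vect}^*(S^1)$ is $\{F,G\}(m)=\int_{S^1}\delta F(m)\,P_m\,\delta G(m)\,dx$ with $P_m=mD+Dm$ (i.e. $P_mu=2mu_x+m_xu$). The Hamiltonian vector field of a regular $F$ for the structure given by $P_m$ (resp. by a constant skew-symmetric operator $Q$) is $P_m\delta F(m)$ (resp. $Q\,\delta F(m)$). The Euler vector field $X_A(m)=P_m(A^{-1}m)=2mu_x+um_x$ ($u=A^{-1}m$) is always Hamiltonian for the Lie-Poisson structure, with Hamiltonian $\frac12\int_{S^1} mA^{-1}m\,dx$. A local $2$-cocycle operator is a linear differential operator $Q=\sum_{k=0}^n a_k(x)D^k$ with $a_k\in C^\infty(S^1)$, skew-symmetric for the $L^2$ inner product, such that $\gamma(u,v)=\int_{S^1}u\,Q(v)\,dx$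 satisfies $\gamma([u,v],w)+\gamma([v,w],u)+\gamma([w,u],v)=0$ for all $u,v,w\in C^\infty(S^1)$. This says that the constant Poisson structure defined by $Q$ is compatible with the canonical Lie-Poisson structure; such $Q$ are the second structures of the modified (affine) Lie-Poisson structures on $\mathrm{Vect}^*(S^1)$. *)

(* Defs.v *)
From Stdlib Require Import Reals Lra Lia ZArith FunctionalExtensionality ProofIrrelevance.
From Coquelicot Require Import Coquelicot.

Open Scope R_scope.

Record circle_fun : Type := CircleFun {
  cfun :> R -> R;
  cfun_periodic : forall x, cfun (x + 2 * PI) = cfun x;
  cfun_smooth : forall n x, ex_derive_n cfun n x }.

Lemma circle_fun_ext (u v : circle_fun) : (forall x, u x = v x) -> u = v.
Proof.
destruct u as [u pu su], v as [v pv sv]; simpl; intros H.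
apply functional_extensionality in H; subst v.
f_equal; apply proof_irrelevance.
Qed.

Lemma smooth_ext (f g : R -> R) :
  (forall x, f x = g x) ->
  (forall n x, ex_derive_n f n x) -> forall n x, ex_derive_n g n x.
Proof.
intros H Hf n x; apply (ex_derive_n_ext f); auto.
Qed.

Lemma smooth_Derive (f : R -> R) :
  (forall n x, ex_derive_n f n x) -> forall n x, ex_derive_n (Derive f) n x.
Proof.
intros Hf [|n] x; [exact I|].
apply (ex_derive_ext (Derive_n f (S n))).
- intros t; symmetry.
  rewrite <- (Nat.add_1_r n); exact (Derive_n_comp f n 1 t).
- exact (Hf (S (S n)) x).
Qed.

Lemma smooth_of_Derive (f : R -> R) (n : nat) :
  (forall x, ex_derive f x) -> (forall x, ex_derive_n (Derive f) n x) ->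
  forall x, ex_derive_n f (S n) x.
Proof.
destruct n as [|n]; intros H1 H2 x; [exact (H1 x)|].
apply (ex_derive_ext (Derive_n (Derive f) n)); [|exact (H2 x)].
intros t; rewrite <- (Nat.add_1_r n); exact (Derive_n_comp f n 1 t).
Qed.

Lemma smooth_plus (f g : R -> R) :
  (forall n x, ex_derive_n f n x) -> (forall n x, ex_derive_n g n x) ->
  forall n x, ex_derive_n (fun y => f y + g y) n x.
Proof.
intros Hf Hg n x; apply ex_derive_n_plus; exists (mkposreal 1 Rlt_0_1); auto.
Qed.

Lemma smooth_mult (f g : R -> R) :
  (forall n x, ex_derive_n f n x) -> (forall n x, ex_derive_n g n x) ->
  forall n x, ex_derive_n (fun y => f y * g y) n x.
Proof.
intros Hf Hg n; revert f g Hf Hg.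
assert (Hle : forall n f g,
  (forall n x, ex_derive_n f n x) -> (forall n x, ex_derive_n g n x) ->
  forall k, (k <= n)%nat -> forall x, ex_derive_n (fun y => f y * g y) k x).
{ clear n; induction n as [|n IH]; intros f g Hf Hg k Hk x.
  - replace k with 0%nat by lia; exact I.
  - destruct k as [|k]; [exact I|].
    assert (Hf1 : forall x, ex_derive f x) by (intros y; exact (Hf 1%nat y)).
    assert (Hg1 : forall x, ex_derive g x) by (intros y; exact (Hg 1%nat y)).
    apply smooth_of_Derive.
    + intros y; apply (ex_derive_mult f g y); auto.
    + intros y.
      apply (ex_derive_n_ext (fun y => Derive f y * g y + f y * Derive g y)).
      * intros t; rewrite Derive_mult; auto.
      * apply ex_derive_n_plus; exists (mkposreal 1 Rlt_0_1);
          intros z _ j Hj; (apply IH; [| |lia]);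
          auto using smooth_Derive. }
intros f g Hf Hg x; exact (Hle n f g Hf Hg n (Nat.le_refl n) x).
Qed.

Program Definition cf_zero : circle_fun := CircleFun (fun _ => 0) _ _.
Next Obligation.
destruct n; [exact I|]; apply ex_derive_n_const.
Qed.

Program Definition cf_plus (u v : circle_fun) : circle_fun :=
  CircleFun (fun x => u x + v x) _ _.
Next Obligation. now rewrite !cfun_periodic. Qed.
Next Obligation. apply smooth_plus; apply cfun_smooth. Qed.

Program Definition cf_mult (u v : circle_fun) : circle_fun :=
  CircleFun (fun x => u x * v x) _ _.
Next Obligation. now rewrite !cfun_periodic. Qed.
Next Obligation. apply smooth_mult; apply cfun_smooth. Qed.

Program Definition cf_scal (c : R) (u : circle_fun) : circle_fun :=
  CircleFun (fun x => c * u x) _ _.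
Next Obligation. now rewrite cfun_periodic. Qed.
Next Obligation. apply ex_derive_n_scal_l, cfun_smooth. Qed.

Program Definition cf_opp (u : circle_fun) : circle_fun :=
  CircleFun (fun x => - u x) _ _.
Next Obligation. now rewrite cfun_periodic. Qed.
Next Obligation. apply ex_derive_n_opp, cfun_smooth. Qed.

Program Definition cf_D (u : circle_fun) : circle_fun :=
  CircleFun (Derive u) _ _.
Next Obligation.
change (Derive_n u 1 (x + 2 * PI) = Derive u x).
rewrite <- (Derive_n_comp_trans u 1 x (2 * PI)).
apply Derive_ext; intros t; apply cfun_periodic.
Qed.
Next Obligation. apply smooth_Derive, cfun_smooth. Qed.

Definition cf_AbelianMonoid_mixin : AbelianMonoid.mixin_of circle_fun.
Proof.
apply (AbelianMonoid.Mixin circle_fun cf_plus cf_zero);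
  intros; apply circle_fun_ext; intros t; simpl; ring.
Defined.

Canonical cf_AbelianMonoid :=
  AbelianMonoid.Pack circle_fun cf_AbelianMonoid_mixin circle_fun.

Definition cf_AbelianGroup_mixin : AbelianGroup.mixin_of cf_AbelianMonoid.
Proof.
apply (AbelianGroup.Mixin cf_AbelianMonoid cf_opp).
intros; apply circle_fun_ext; intros t; simpl; ring.
Defined.

Canonical cf_AbelianGroup :=
  AbelianGroup.Pack circle_fun
    (AbelianGroup.Class circle_fun cf_AbelianMonoid_mixin cf_AbelianGroup_mixin)
    circle_fun.

Definition cf_ModuleSpace_mixin : ModuleSpace.mixin_of R_Ring cf_AbelianGroup.
Proof.
apply (ModuleSpace.Mixin R_Ring cf_AbelianGroup cf_scal);
  intros; apply circle_fun_ext; intros t; simpl;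
  unfold mult, plus, one; simpl; ring.
Defined.

Canonical cf_ModuleSpace :=
  ModuleSpace.Pack R_Ring circle_fun
    (ModuleSpace.Class R_Ring circle_fun (AbelianGroup.class cf_AbelianGroup)
       cf_ModuleSpace_mixin)
    circle_fun.

(** The Frechet topology of uniform convergence of every derivative.  A
    [UniformSpace] has balls with a single parameter, so the ball of radius [e]
    bounds the sup-seminorms of order at most [1 / e]; as [e] tends to [0] these
    balls form a basis of neighbourhoods for the family of all the seminorms
    [sup |D^k u|].  The ball is empty when [e <= 0] (take [k = 0]). *)
Definition cf_ball (u : circle_fun) (e : R) (v : circle_fun) : Prop :=
  forall (k : nat) (x : R), INR k * e <= 1 ->
    Rabs (Derive_n v k x - Derive_n u k x) < e.

Definition cf_UniformSpace_mixin : UniformSpace.mixin_of circle_fun.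
Proof.
apply (UniformSpace.Mixin circle_fun cf_zero cf_ball).
- intros u e k x _; rewrite Rminus_diag, Rabs_R0; apply cond_pos.
- intros u v e H k x Hk; rewrite Rabs_minus_sym; auto.
- intros u v w e1 e2 H1 H2 k x Hk.
  assert (P1 : 0 < e1).
  { apply Rle_lt_trans with (1 := Rabs_pos _) (2 := H1 0%nat x ltac:(simpl; lra)). }
  assert (P2 : 0 < e2).
  { apply Rle_lt_trans with (1 := Rabs_pos _) (2 := H2 0%nat x ltac:(simpl; lra)). }
  pose proof (pos_INR k).
  assert (K1 : INR k * e1 <= 1) by nra.
  assert (K2 : INR k * e2 <= 1) by nra.
  specialize (H1 k x K1); specialize (H2 k x K2).
  replace (Derive_n w k x - Derive_n u k x) with
    ((Derive_n v k x - Derive_n u k x) + (Derive_n w k x - Derive_n v k x)) by ring.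
  apply Rle_lt_trans with (1 := Rabs_triang _ _); lra.
Defined.

Canonical cf_UniformSpace :=
  UniformSpace.Pack circle_fun cf_UniformSpace_mixin circle_fun.

Canonical cf_NormedModuleAux :=
  NormedModuleAux.Pack R_AbsRing circle_fun
    (NormedModuleAux.Class R_AbsRing circle_fun
       (ModuleSpace.class R_Ring cf_ModuleSpace) cf_UniformSpace_mixin)
    circle_fun.

(** [NormedModuleAux R_AbsRing] is a real vector space with a uniform structure;
    no norm is involved. *)

Definition is_dir_derive {V W : NormedModuleAux R_AbsRing}
    (F : V -> W) (m h : V) (l : W) : Prop :=
  filterlim (fun t : R => scal (/ t) (minus (F (plus m (scal t h))) (F m)))
    (locally' 0) (locally l).

(** [C^n] in the sense of Hamilton (and Michal-Bastiani): [F] is [C^(n+1)] when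
    [(m, h) |-> dF(m)h] exists and is [C^n] on the product space. *)
Fixpoint class_C (n : nat) :
    forall V W : NormedModuleAux R_AbsRing, (V -> W) -> Prop :=
  match n with
  | O => fun V W F => forall m : V, continuous F m
  | S n => fun V W F =>
      (forall m : V, continuous F m) /\
      exists dF : V * V -> W,
        (forall m h : V, is_dir_derive F m h (dF (m, h))) /\
        class_C n (prod_NormedModuleAux R_AbsRing V V) W dF
  end.

Definition smooth_map {V W : NormedModuleAux R_AbsRing} (F : V -> W) : Prop :=
  forall n, class_C n V W F.

Definition L2 (u v : circle_fun) : R :=
  RInt (fun x => u x * v x) 0 (2 * PI).

Definition regular (F : circle_fun -> R) (dF : circle_fun -> circle_fun) : Prop :=
  smooth_map F /\ smooth_map dF /\
  forall m M, is_dir_derive F m M (L2 M (dF m)).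

Definition bracket (u v : circle_fun) : circle_fun :=
  minus (cf_mult u (cf_D v)) (cf_mult (cf_D u) v).

Definition diff_operator (Q : circle_fun -> circle_fun) : Prop :=
  exists (n : nat) (a : nat -> circle_fun),
    forall u, Q u = sum_n (fun k => cf_mult (a k) (Nat.iter k cf_D u)) n.

Definition const_coeff_diff_operator (A : circle_fun -> circle_fun) : Prop :=
  exists (n : nat) (c : nat -> R),
    forall u, A u = sum_n (fun k => scal (c k) (Nat.iter k cf_D u)) n.

Definition L2_symmetric (A : circle_fun -> circle_fun) : Prop :=
  forall u v, L2 (A u) v = L2 u (A v).

Definition L2_skew (Q : circle_fun -> circle_fun) : Prop :=
  forall u v, L2 (Q u) v = - L2 u (Q v).

Definition local_cocycle (Q : circle_fun -> circle_fun) : Prop :=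
  let gamma u v := L2 u (Q v) in
  diff_operator Q /\ L2_skew Q /\
  forall u v w,
    gamma (bracket u v) w + gamma (bracket v w) u + gamma (bracket w u) v = 0.

Definition continuous_linear (A : circle_fun -> circle_fun) : Prop :=
  (forall u v, A (plus u v) = plus (A u) (A v)) /\
  (forall (c : R) u, A (scal c u) = scal c (A u)) /\
  (forall u, continuous A u).

(** [A] is an isomorphism of topological vector spaces with inverse [Ainv]. *)
Definition continuous_linear_iso (A Ainv : circle_fun -> circle_fun) : Prop :=
  continuous_linear A /\ continuous_linear Ainv /\
  (forall u, Ainv (A u) = u) /\ (forall m, A (Ainv m) = m).

(** [P_m = m D + D m]. *)
Definition lie_poisson (m u : circle_fun) : circle_fun :=
  plus (scal 2 (cf_mult m (cf_D u))) (cf_mult (cf_D m) u).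

Definition euler_field (Ainv : circle_fun -> circle_fun) (m : circle_fun) :
    circle_fun :=
  lie_poisson m (Ainv m).

Definition second_hamiltonian (Q : circle_fun -> circle_fun)
    (F : circle_fun -> R) (X : circle_fun -> circle_fun) : Prop :=
  local_cocycle Q /\ exists dF, regular F dF /\ forall m, X m = Q (dF m).

(** An Euler vector field is always Hamiltonian for the Lie-Poisson structure,
    so only the second structure is a condition. *)
Definition bi_hamiltonian_euler (Ainv : circle_fun -> circle_fun) : Prop :=
  exists Q F, second_hamiltonian Q F (euler_field Ainv).

Definition aI_bD2 (a b : R) (u : circle_fun) : circle_fun :=
  plus (scal a u) (scal b (cf_D (cf_D u))).

Definition aD_bD3 (a b : R) (u : circle_fun) : circle_fun :=
  plus (scal a (cf_D u)) (scal b (cf_D (cf_D (cf_D u)))).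

Definition H3 (a b : R) (Ainv : circle_fun -> circle_fun) (m : circle_fun) : R :=
  let u := Ainv m in
  1 / 2 * RInt (fun x => a * u x ^ 3 - b * u x * cf_D u x ^ 2) 0 (2 * PI).

(* Main.v *)
(** Suppose [X_A = Q dF].  Differentiating [F] along [Q v] and [Q w] and using the
    symmetry of its second derivative, the derivative of [X_A] at [m] composed with [Q] is
    symmetric.  At [m = 1] that derivative is a Fourier multiplier with
    eigenvalues [i n (1 / al 0 + 2 / al n)], [al] being the symbol of [A]; unless [A] is
    scalar they are distinct for large modes, so [Q] is diagonal there, with a polynomial
    symbol [i q n] ([q n] being [sig n] below, up to normalization).  The cocycle identity
    for the modes [k], [2 k], [3 k] reads [q (3 k) = 4 q (2 k) - 5 q k] and forces
    [q n = c1 n + c3 n ^ 3].  The symmetry at the mode [k], tested on the modes [k] and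
    [2 k], reads [2 q k / al k = q (2 k) / al (2 k)]; comparing coefficients, [al] has only
    terms of degree [0] and [2] unless [q = 0].  In the latter case [Q] kills a large mode,
    which contradicts [X_A = Q dF] at [m = cos (k x) - sin (k x)].

    Conversely, [A] is inverted by convolution with a Green kernel, and [H_3] and its
    gradient are polynomial maps, hence smooth. *)
Require Import Defs.
From Stdlib Require Import Reals ZArith Lra Lia FunctionalExtensionality.
From Coquelicot Require Import Coquelicot.
Open Scope R_scope.

(** * Calculus on the circle *)

(** [F] is never differentiated twice. Skewness of [Q] turns [dF(m)(Q u)] into [- <u, X_A(m)>], and
    [X_A] is quadratic because [A] is linear; so on the plane [m + s Q v + t Q w] both partial
    derivatives of [F] are explicit quadratic polynomials in [s] and [t], and the equality of the
    mixed coefficients is elementary.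

    The coefficients of [Q] may depend on [x], so [Q] may couple any two modes. In real form the
    symmetry at [m = 1] exchanges [cos] and [sin], and what it gives is a linear system with
    determinant [ell j ^ 2 - ell n ^ 2], which can vanish for low modes. Every spectral relation is
    therefore stated beyond some [n1], and conclusions are drawn by comparing coefficients of
    polynomials that agree at all large integers.

    If [A] is scalar the conclusion holds with [b = 0]. Otherwise its symbol, being even, grows
    faster than [n], whence [al 0 * ell n = n + o(1)]: this is what separates the large modes. *)

Lemma iter_D_Derive_n (u : circle_fun) (k : nat) (x : R) :
  Nat.iter k cf_D u x = Derive_n u k x.
Proof.
revert x; induction k as [|k IH]; intros x; [reflexivity|].
simpl; apply Derive_ext; exact IH.
Qed.

Lemma cf_ex_derive (u : circle_fun) (x : R) : ex_derive u x.
Proof. exact (cfun_smooth u 1 x). Qed.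

Lemma cf_continuous (u : circle_fun) (x : R) : continuous u x.
Proof. apply (ex_derive_continuous (V := R_NormedModule)), cf_ex_derive. Qed.

Lemma cf_plusE (u v : circle_fun) (x : R) : plus u v x = u x + v x.
Proof. reflexivity. Qed.

Lemma cf_scalE (c : R) (u : circle_fun) (x : R) : scal c u x = c * u x.
Proof. reflexivity. Qed.

Lemma cf_oppE (u : circle_fun) (x : R) : opp u x = - u x.
Proof. reflexivity. Qed.

Lemma cf_minusE (u v : circle_fun) (x : R) : minus u v x = u x - v x.
Proof. reflexivity. Qed.

Lemma cf_multE (u v : circle_fun) (x : R) : cf_mult u v x = u x * v x.
Proof. reflexivity. Qed.

Lemma cf_zeroE (x : R) : (zero : circle_fun) x = 0.
Proof. reflexivity. Qed.

Lemma cf_D_plusE (u v : circle_fun) (x : R) :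
  cf_D (plus u v) x = cf_D u x + cf_D v x.
Proof. apply (Derive_plus u v); apply cf_ex_derive. Qed.

Lemma cf_D_scalE (c : R) (u : circle_fun) (x : R) :
  cf_D (scal c u) x = c * cf_D u x.
Proof. apply (Derive_scal u c). Qed.

Lemma cf_D_oppE (u : circle_fun) (x : R) : cf_D (opp u) x = - cf_D u x.
Proof. apply (Derive_opp u). Qed.

Lemma cf_D_minusE (u v : circle_fun) (x : R) :
  cf_D (minus u v) x = cf_D u x - cf_D v x.
Proof. unfold minus; rewrite cf_D_plusE, cf_D_oppE; reflexivity. Qed.

Lemma cf_D_multE (u v : circle_fun) (x : R) :
  cf_D (cf_mult u v) x = cf_D u x * v x + u x * cf_D v x.
Proof. apply (Derive_mult u v); apply cf_ex_derive. Qed.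

Lemma cf_D_plus (u v : circle_fun) : cf_D (plus u v) = plus (cf_D u) (cf_D v).
Proof. apply circle_fun_ext; intros x; apply cf_D_plusE. Qed.

Lemma cf_D_scal (c : R) (u : circle_fun) : cf_D (scal c u) = scal c (cf_D u).
Proof. apply circle_fun_ext; intros x; apply cf_D_scalE. Qed.

Lemma cf_D_minus (u v : circle_fun) : cf_D (minus u v) = minus (cf_D u) (cf_D v).
Proof. apply circle_fun_ext; intros x; apply cf_D_minusE. Qed.

Lemma cf_D_mult (u v : circle_fun) :
  cf_D (cf_mult u v) = plus (cf_mult (cf_D u) v) (cf_mult u (cf_D v)).
Proof. apply circle_fun_ext; intros x; apply cf_D_multE. Qed.

Ltac cf_expand :=
  unfold lie_poisson, bracket, aI_bD2, aD_bD3;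
  repeat rewrite ?cf_D_plus, ?cf_D_scal, ?cf_D_minus, ?cf_D_mult;
  repeat rewrite ?cf_plusE, ?cf_scalE, ?cf_minusE, ?cf_oppE, ?cf_multE, ?cf_zeroE.

Ltac cf_ring := apply circle_fun_ext; intros ?x; cf_expand; ring.

Lemma iter_D_plus (k : nat) (u v : circle_fun) :
  Nat.iter k cf_D (plus u v) = plus (Nat.iter k cf_D u) (Nat.iter k cf_D v).
Proof.
induction k as [|k IH]; [reflexivity|]; simpl; rewrite IH; apply cf_D_plus.
Qed.

Lemma iter_D_minus (k : nat) (u v : circle_fun) :
  Nat.iter k cf_D (minus u v) = minus (Nat.iter k cf_D u) (Nat.iter k cf_D v).
Proof.
induction k as [|k IH]; [reflexivity|]; simpl; rewrite IH; apply cf_D_minus.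
Qed.

Lemma iter_D_scal (k : nat) (c : R) (u : circle_fun) :
  Nat.iter k cf_D (scal c u) = scal c (Nat.iter k cf_D u).
Proof.
induction k as [|k IH]; [reflexivity|]; simpl; rewrite IH; apply cf_D_scal.
Qed.

(** * Integration over the circle and the [L2] pairing *)

Definition cf_int (u : circle_fun) : R := RInt u 0 (2 * PI).

Lemma cf_ex_RInt (u : circle_fun) (a b : R) : ex_RInt u a b.
Proof. apply (ex_RInt_continuous (V := R_CompleteNormedModule)); intros; apply cf_continuous. Qed.

Lemma cf_int_plus (u v : circle_fun) : cf_int (plus u v) = cf_int u + cf_int v.
Proof. apply (RInt_plus (V := R_CompleteNormedModule) u v); apply cf_ex_RInt. Qed.

Lemma cf_int_scal (c : R) (u : circle_fun) : cf_int (scal c u) = c * cf_int u.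
Proof. apply (RInt_scal (V := R_CompleteNormedModule) u); apply cf_ex_RInt. Qed.

Lemma cf_int_D (u : circle_fun) : cf_int (cf_D u) = 0.
Proof.
unfold cf_int.
transitivity (u (2 * PI) - u 0).
- apply (RInt_Derive u); intros; [apply cf_ex_derive|apply (cf_continuous (cf_D u))].
- rewrite <- (Rplus_0_l (2 * PI)), cfun_periodic; ring.
Qed.

(** Integrations by parts take this form: [w] is the primitive of the difference, and what remains
    is a pointwise identity that [ring] can settle. *)
Lemma cf_int_parts (w u v : circle_fun) :
  (forall x, u x = v x + cf_D w x) -> cf_int u = cf_int v.
Proof.
intros H; replace u with (plus v (cf_D w)).
- rewrite cf_int_plus, cf_int_D; ring.
- apply circle_fun_ext; intros x; rewrite H; reflexivity.
Qed.

Lemma L2_int (u v : circle_fun) : L2 u v = cf_int (cf_mult u v).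
Proof. reflexivity. Qed.

Lemma L2_comm (u v : circle_fun) : L2 u v = L2 v u.
Proof. rewrite !L2_int; f_equal; cf_ring. Qed.

Lemma L2_plus_r (u v w : circle_fun) : L2 u (plus v w) = L2 u v + L2 u w.
Proof. rewrite !L2_int, <- cf_int_plus; f_equal; cf_ring. Qed.

Lemma L2_scal_r (c : R) (u v : circle_fun) : L2 u (scal c v) = c * L2 u v.
Proof. rewrite !L2_int, <- cf_int_scal; f_equal; cf_ring. Qed.

Lemma L2_plus_l (u v w : circle_fun) : L2 (plus v w) u = L2 v u + L2 w u.
Proof. rewrite !(L2_comm _ u); apply L2_plus_r. Qed.

Lemma L2_scal_l (c : R) (u v : circle_fun) : L2 (scal c v) u = c * L2 v u.
Proof. rewrite !(L2_comm _ u); apply L2_scal_r. Qed.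

Lemma cf_minus_scal (u v : circle_fun) : minus u v = plus u (scal (-1) v).
Proof. cf_ring. Qed.

Lemma L2_minus_r (u v w : circle_fun) : L2 u (minus v w) = L2 u v - L2 u w.
Proof. rewrite cf_minus_scal, L2_plus_r, L2_scal_r; ring. Qed.

Lemma L2_minus_l (u v w : circle_fun) : L2 (minus v w) u = L2 v u - L2 w u.
Proof. rewrite !(L2_comm _ u); apply L2_minus_r. Qed.

Lemma L2_D (u v : circle_fun) : L2 (cf_D u) v = - L2 u (cf_D v).
Proof.
rewrite !L2_int.
replace (- cf_int (cf_mult u (cf_D v)))
  with (cf_int (scal (-1) (cf_mult u (cf_D v)))) by (rewrite cf_int_scal; ring).
apply (cf_int_parts (cf_mult u v)); intros x; cf_expand; ring.
Qed.

(** The two integrands differ by the derivative of [v m u]. This is the coadjoint form of the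
    operator; it frees [m] from all derivatives. *)
Lemma L2_lie_poisson_bracket (v m u : circle_fun) :
  L2 v (lie_poisson m u) = L2 m (bracket v u).
Proof.
rewrite !L2_int; apply (cf_int_parts (cf_mult v (cf_mult m u))).
intros x; cf_expand; ring.
Qed.

Lemma L2_lie_poisson_skew (v m u : circle_fun) :
  L2 v (lie_poisson m u) = - L2 u (lie_poisson m v).
Proof.
rewrite !L2_int.
replace (- cf_int (cf_mult u (lie_poisson m v)))
  with (cf_int (scal (-1) (cf_mult u (lie_poisson m v)))) by (rewrite cf_int_scal; ring).
apply (cf_int_parts (scal 2 (cf_mult v (cf_mult m u)))).
intros x; cf_expand; ring.
Qed.

Lemma L2_sum_n_r (u : circle_fun) (f : nat -> circle_fun) (n : nat) :
  L2 u (sum_n f n) = sum_n (fun k => L2 u (f k)) n.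
Proof.
induction n as [|n IH]; [now rewrite !sum_O|].
rewrite !sum_Sn, L2_plus_r, IH; reflexivity.
Qed.

Lemma symmetric_inverse (A Ainv : circle_fun -> circle_fun) (u v : circle_fun) :
  L2_symmetric A -> (forall m, A (Ainv m) = m) -> L2 (Ainv u) v = L2 u (Ainv v).
Proof.
intros HA HI; rewrite <- (HI v) at 1; rewrite <- HA, HI; reflexivity.
Qed.

(** * Smoothness of polynomial maps *)

Lemma cf_periodic_Z (u : circle_fun) (n : Z) (x : R) : u (x + 2 * PI * IZR n) = u x.
Proof.
assert (N : forall (k : nat) y, u (y + 2 * PI * INR k) = u y).
{ induction k as [|k IH]; intros y.
  - simpl; f_equal; ring.
  - rewrite <- (IH y), <- (cfun_periodic u (y + 2 * PI * INR k)), S_INR; f_equal; ring. }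
destruct (Z_le_dec 0 n) as [Hn|Hn].
- rewrite <- (Z2Nat.id n Hn), <- INR_IZR_INZ; apply N.
- rewrite <- (N (Z.to_nat (- n)) (x + 2 * PI * IZR n)).
  f_equal; rewrite INR_IZR_INZ, Z2Nat.id, opp_IZR by lia; ring.
Qed.

Lemma cf_reduce (u : circle_fun) (x : R) :
  exists y, 0 <= y <= 2 * PI /\ u x = u y.
Proof.
pose proof PI_RGT_0 as HPI.
destruct (base_Int_part (x / (2 * PI))) as [H1 H2].
set (n := Int_part (x / (2 * PI))) in *.
assert (Hx : x = x / (2 * PI) * (2 * PI)) by (field; lra).
exists (x + 2 * PI * IZR (- n)); split.
- rewrite opp_IZR; set (q := x / (2 * PI)) in *; nra.
- now rewrite cf_periodic_Z.
Qed.

Lemma cf_bounded (u : circle_fun) : exists M, 0 < M /\ forall x, Rabs (u x) <= M.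
Proof.
destruct (bounded_continuity (V := R_NormedModule) u 0 (2 * PI)) as [M HM].
{ intros x _; apply cf_continuous. }
assert (HM' : forall x, Rabs (u x) < M).
{ intros x; destruct (cf_reduce u x) as [y [Hy E]]; rewrite E; exact (HM y Hy). }
exists M; split.
- apply Rle_lt_trans with (1 := Rabs_pos (u 0)); apply HM'.
- intros x; left; apply HM'.
Qed.

(** A ball of radius [e] constrains only the orders [k <= 1 / e], so finitely many seminorm
    conditions suffice. Iterates of [cf_D] stand in for [Derive_n], which makes the algebraic rules
    for [cf_D] available. *)
Lemma cf_filterlim_iff {T} (F : (T -> Prop) -> Prop) {FF : Filter F}
    (f : T -> circle_fun) (l : circle_fun) :
  filterlim f F (locally l) <->
  forall k e, 0 < e ->
    F (fun y => forall x, Rabs (Nat.iter k cf_D (f y) x - Nat.iter k cf_D l x) < e).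
Proof.
split.
- intros H k e He.
  assert (Hk : 0 < / (INR k + 1)) by (apply Rinv_0_lt_compat; pose proof (pos_INR k); lra).
  (* A radius at most [/ (INR k + 1)] makes the ball control the order [k]. *)
  assert (He' : 0 < Rmin e (/ (INR k + 1))) by now apply Rmin_glb_lt.
  assert (P : locally l (fun v : circle_fun =>
    forall x, Rabs (Nat.iter k cf_D v x - Nat.iter k cf_D l x) < e)).
  { exists (mkposreal _ He'); intros v Hv x.
    rewrite !iter_D_Derive_n.
    apply Rlt_le_trans with (Rmin e (/ (INR k + 1))); [|apply Rmin_l].
    apply (Hv k x); simpl.
    pose proof (pos_INR k).
    apply Rle_trans with ((INR k + 1) * / (INR k + 1)); [|right; field; lra].
    apply Rmult_le_compat; [lra|now left|lra|apply Rmin_r]. }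
  exact (H _ P).
- intros H P [e He].
  destruct (nfloor_ex (/ e)) as [N HN]; [left; apply Rinv_0_lt_compat, cond_pos|].
  assert (A : F (fun y => forall k, (k <= N)%nat -> forall x,
    Rabs (Nat.iter k cf_D (f y) x - Nat.iter k cf_D l x) < e)).
  { clear HN; induction N as [|N IH].
    - generalize (H 0%nat e (cond_pos e)); apply filter_imp; intros y Hy k Hk.
      replace k with 0%nat by lia; exact Hy.
    - generalize (filter_and _ _ IH (H (S N) e (cond_pos e))); apply filter_imp.
      intros y [H1 H2] k Hk.
      destruct (Nat.eq_dec k (S N)) as [->|E]; [exact H2|apply H1; lia]. }
  unfold filtermap; revert A; apply filter_imp; intros y Hy; apply He; intros k x Hk.
  rewrite <- !iter_D_Derive_n; apply Hy.
  apply Nat.lt_succ_r, INR_lt; rewrite S_INR.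
  apply Rle_lt_trans with (/ e); [|apply HN].
  apply (Rmult_le_reg_r e); [apply cond_pos|].
  rewrite Rinv_l; [exact Hk|apply Rgt_not_eq, cond_pos].
Qed.

Section Filterlim.
Context {T : Type} (F : (T -> Prop) -> Prop) {FF : Filter F}.

Lemma cf_filterlim_D (f : T -> circle_fun) (l : circle_fun) :
  filterlim f F (locally l) -> filterlim (fun y => cf_D (f y)) F (locally (cf_D l)).
Proof.
rewrite !cf_filterlim_iff by exact FF; intros H k e He.
generalize (H (S k) e He); apply filter_imp; intros y Hy x.
rewrite <- !Nat.iter_succ_r; apply Hy.
Qed.

Lemma cf_filterlim_plus (f g : T -> circle_fun) (l l' : circle_fun) :
  filterlim f F (locally l) -> filterlim g F (locally l') ->
  filterlim (fun y => plus (f y) (g y)) F (locally (plus l l')).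
Proof.
rewrite !cf_filterlim_iff by exact FF; intros Hf Hg k e He.
generalize (filter_and (F := F) _ _ (Hf k (e / 2) ltac:(lra)) (Hg k (e / 2) ltac:(lra))).
apply filter_imp; intros y [H1 H2] x.
rewrite !iter_D_plus, !cf_plusE; specialize (H1 x); specialize (H2 x).
revert H1 H2; unfold Rabs; repeat destruct Rcase_abs; lra.
Qed.

(** Leibniz's rule lowers [k] and reduces everything to sup norms, where the limits are bounded by
    periodicity; [f] and [g] are generalized because the induction passes to their derivatives. *)
Lemma cf_filterlim_mult (f g : T -> circle_fun) (l l' : circle_fun) :
  filterlim f F (locally l) -> filterlim g F (locally l') ->
  filterlim (fun y => cf_mult (f y) (g y)) F (locally (cf_mult l l')).
Proof.
intros Hf Hg; rewrite cf_filterlim_iff by exact FF; intros k; revert f g l l' Hf Hg.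
induction k as [|k IH]; intros f g l l' Hf Hg e He.
- destruct (cf_bounded l) as [M [HM Hl]], (cf_bounded l') as [M' [HM' Hl']].
  (* The error is at most [d ^ 2 + d * M' + M * d], hence at most [d * (M + M' + 1)] as [d <= 1]. *)
  assert (Hd : 0 < Rmin 1 (e / (M + M' + 1))).
  { apply Rmin_glb_lt; [lra|apply Rdiv_lt_0_compat; lra]. }
  set (d := Rmin 1 (e / (M + M' + 1))) in *.
  assert (Hd1 : d <= 1) by apply Rmin_l.
  assert (Hd2 : d * (M + M' + 1) <= e).
  { apply Rle_trans with (e / (M + M' + 1) * (M + M' + 1)); [|right; field; lra].
    apply Rmult_le_compat_r; [lra|apply Rmin_r]. }
  rewrite cf_filterlim_iff in Hf, Hg by exact FF.
  generalize (filter_and (F := F) _ _ (Hf 0%nat d Hd) (Hg 0%nat d Hd)).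
  apply filter_imp; intros y [H1 H2] x; simpl in *.
  specialize (H1 x); specialize (H2 x); specialize (Hl x); specialize (Hl' x).
  replace (f y x * g y x - l x * l' x) with
    ((f y x - l x) * (g y x - l' x) + (f y x - l x) * l' x + l x * (g y x - l' x)) by ring.
  apply Rle_lt_trans with (1 := Rabs_triang _ _); rewrite Rabs_mult.
  apply Rle_lt_trans with (1 := Rplus_le_compat_r _ _ _ (Rabs_triang _ _)).
  rewrite !Rabs_mult.
  pose proof (Rabs_pos (f y x - l x)); pose proof (Rabs_pos (g y x - l' x)).
  pose proof (Rabs_pos (l x)); pose proof (Rabs_pos (l' x)).
  nra.
- generalize (filter_and (F := F) _ _
    (IH _ _ _ _ (cf_filterlim_D _ _ Hf) Hg (e / 2) ltac:(lra))
    (IH _ _ _ _ Hf (cf_filterlim_D _ _ Hg) (e / 2) ltac:(lra))).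
  apply filter_imp; intros y [H1 H2] x.
  rewrite !Nat.iter_succ_r, !cf_D_mult, !iter_D_plus, !cf_plusE.
  specialize (H1 x); specialize (H2 x).
  revert H1 H2; unfold Rabs; repeat destruct Rcase_abs; lra.
Qed.

Lemma cf_filterlim_scal_0 (a : T -> R) (f : T -> circle_fun) (l : circle_fun) :
  filterlim a F (locally 0) -> filterlim f F (locally l) ->
  filterlim (fun y => scal (a y) (f y)) F (locally cf_zero).
Proof.
rewrite !cf_filterlim_iff by exact FF; intros Ha Hf k e He.
destruct (cf_bounded (Nat.iter k cf_D l)) as [M [HM Hl]].
assert (Hd : 0 < e / (M + 1)) by (apply Rdiv_lt_0_compat; lra).
generalize (filter_and (F := F) _ _ (Ha _ (locally_ball 0 (mkposreal _ Hd))) (Hf k 1 ltac:(lra))).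
apply filter_imp; intros y [H1 H2] x.
replace cf_zero with (scal 0 l) by (apply circle_fun_ext; intros t; cf_expand; simpl; ring).
rewrite !iter_D_scal, !cf_scalE.
change (Rabs (a y + - 0) < e / (M + 1)) in H1.
rewrite Ropp_0, Rplus_0_r in H1.
specialize (H2 x); specialize (Hl x).
rewrite Rmult_0_l, Rminus_0_r, Rabs_mult.
assert (Rabs (Nat.iter k cf_D (f y) x) < M + 1).
{ revert H2 Hl; unfold Rabs; repeat destruct Rcase_abs; lra. }
replace e with (e / (M + 1) * (M + 1)) by (field; lra).
apply Rmult_le_0_lt_compat; auto using Rabs_pos.
Qed.

End Filterlim.

(** [continuous_linear] between arbitrary spaces, so that the projections of a product and the
    integral are included; on [circle_fun] the two are convertible. *)
Definition cont_linear {V W : NormedModuleAux R_AbsRing} (L : V -> W) : Prop :=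
  (forall u v, L (plus u v) = plus (L u) (L v)) /\
  (forall (c : R) u, L (scal c u) = scal c (L u)) /\
  (forall u, continuous L u).

Lemma cont_linear_minus {V W : NormedModuleAux R_AbsRing} (L : V -> W) (u v : V) :
  cont_linear L -> L (minus u v) = minus (L u) (L v).
Proof.
intros [Hp [Hs _]]; unfold minus; rewrite Hp; f_equal.
transitivity (L (scal (-1) v)).
- f_equal; symmetry; exact (scal_opp_one (K := R_Ring) v).
- rewrite Hs; exact (scal_opp_one (K := R_Ring) (L v)).
Qed.

Lemma cont_linear_comp {U V W : NormedModuleAux R_AbsRing} (L : V -> W) (M : U -> V) :
  cont_linear L -> cont_linear M -> cont_linear (fun x => L (M x)).
Proof.
intros [Lp [Ls Lc]] [Mp [Ms Mc]]; split; [|split].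
- intros; rewrite Mp; apply Lp.
- intros; rewrite Ms; apply Ls.
- intros u; apply (continuous_comp M L); auto.
Qed.

Lemma cont_linear_fst (V W : NormedModuleAux R_AbsRing) :
  cont_linear (V := prod_NormedModuleAux R_AbsRing V W) (W := V) fst.
Proof. split; [|split]; try reflexivity; intros [u v]; apply continuous_fst. Qed.

Lemma cont_linear_snd (V W : NormedModuleAux R_AbsRing) :
  cont_linear (V := prod_NormedModuleAux R_AbsRing V W) (W := W) snd.
Proof. split; [|split]; try reflexivity; intros [u v]; apply continuous_snd. Qed.

Lemma cont_linear_id : cont_linear (fun u : circle_fun => u).
Proof. split; [|split]; try reflexivity; intros u; apply continuous_id. Qed.

Lemma cont_linear_D : cont_linear cf_D.
Proof.
split; [exact cf_D_plus|split; [exact cf_D_scal|]]; intros u.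
apply (cf_filterlim_D (locally u) (fun v => v)), filterlim_id.
Qed.

Lemma cont_linear_scal (a : R) : cont_linear (fun u : circle_fun => scal a u).
Proof.
split; [|split].
- intros; cf_ring.
- intros; cf_ring.
- intros u; apply cf_filterlim_iff; [apply locally_filter|]; intros k e He.
  assert (Hd : 0 < e / (Rabs a + 1)).
  { apply Rdiv_lt_0_compat; [exact He|pose proof (Rabs_pos a); lra]. }
  pose proof (proj1 (cf_filterlim_iff (locally u) (fun v => v) u) (filterlim_id _ _) k _ Hd) as H.
  revert H; apply filter_imp; intros v Hv x; specialize (Hv x).
  rewrite !iter_D_scal, !cf_scalE, <- Rmult_minus_distr_l, Rabs_mult.
  pose proof (Rabs_pos a).
  replace e with ((Rabs a + 1) * (e / (Rabs a + 1))) by (field; lra).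
  set (d := e / (Rabs a + 1)) in *.
  pose proof (Rabs_pos (Nat.iter k cf_D v x - Nat.iter k cf_D u x)); nra.
Qed.

Lemma cont_linear_plus (L M : circle_fun -> circle_fun) :
  cont_linear L -> cont_linear M -> cont_linear (fun u => plus (L u) (M u)).
Proof.
intros [Lp [Ls Lc]] [Mp [Ms Mc]]; split; [|split].
- intros; rewrite Lp, Mp; cf_ring.
- intros; rewrite Ls, Ms; cf_ring.
- intros u; apply cf_filterlim_plus; [apply locally_filter|apply Lc|apply Mc].
Qed.

(* Continuity from a sup-norm bound alone: every seminorm is a sup norm of a derivative. *)
Lemma cont_linear_bounded (L : circle_fun -> circle_fun) (C : R) :
  (forall u v, L (plus u v) = plus (L u) (L v)) ->
  (forall (c : R) u, L (scal c u) = scal c (L u)) ->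
  (forall u, cf_D (L u) = L (cf_D u)) ->
  0 < C ->
  (forall (u : circle_fun) M, (forall x, Rabs (u x) <= M) -> forall x, Rabs (L u x) <= C * M) ->
  cont_linear L.
Proof.
intros Hp Hs HD HC HL; split; [exact Hp|split; [exact Hs|]].
assert (HDk : forall k u, Nat.iter k cf_D (L u) = L (Nat.iter k cf_D u)).
{ induction k as [|k IH]; intros u; [reflexivity|].
  rewrite !Nat.iter_succ_r, HD; apply IH. }
intros u; apply cf_filterlim_iff; [apply locally_filter|]; intros k e He.
assert (Hd : 0 < e / (2 * C)) by (apply Rdiv_lt_0_compat; lra).
pose proof (proj1 (cf_filterlim_iff (locally u) (fun v => v) u) (filterlim_id _ _) k _ Hd) as H.
revert H; apply filter_imp; intros v Hv x.
rewrite <- cf_minusE, <- iter_D_minus, cf_minus_scal, <- Hs, <- Hp, <- cf_minus_scal, HDk, iter_D_minus.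
apply Rle_lt_trans with (C * (e / (2 * C))).
- apply HL; intros y; rewrite cf_minusE; left; apply Hv.
- replace (C * (e / (2 * C))) with (e / 2) by (field; lra); lra.
Qed.

Lemma cont_linear_int : cont_linear (V := cf_NormedModuleAux) (W := R_NormedModuleAux) cf_int.
Proof.
split; [exact cf_int_plus|split; [exact cf_int_scal|]].
intros u P [e He]; unfold filtermap.
pose proof PI_RGT_0.
assert (Hd : 0 < e / (4 * PI)) by (apply Rdiv_lt_0_compat; [apply cond_pos|lra]).
pose proof (proj1 (cf_filterlim_iff (locally u) (fun v => v) u) (filterlim_id _ _) 0%nat _ Hd) as Hb.
revert Hb; apply filter_imp; intros v Hv; apply He.
change (Rabs (cf_int v - cf_int u) < e).
replace (cf_int v - cf_int u) with (cf_int (minus v u)).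
2:{ rewrite cf_minus_scal, cf_int_plus, cf_int_scal; ring. }
apply Rle_lt_trans with ((2 * PI - 0) * (e / (4 * PI))).
- apply (norm_RInt_le_const (V := R_NormedModule) (minus v u) 0 (2 * PI)); [lra| |].
  + intros x _; left; apply (Hv x).
  + apply (RInt_correct (V := R_CompleteNormedModule)), cf_ex_RInt.
- replace ((2 * PI - 0) * (e / (4 * PI))) with (e / 2) by (field; lra).
  pose proof (cond_pos e); lra.
Qed.

(** * Directional derivatives *)

Lemma module_diff_quotient {V : ModuleSpace R_Ring} (m h : V) (t : R) :
  t <> 0 -> scal (/ t) (minus (plus m (scal t h)) m) = h.
Proof.
intros Ht.
assert (E : minus (plus m (scal t h)) m = scal t h).
{ unfold minus.
  etransitivity; [exact (f_equal (fun y => plus y (opp m)) (plus_comm m (scal t h)))|].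
  etransitivity; [symmetry; apply plus_assoc|].
  etransitivity; [exact (f_equal (plus (scal t h)) (plus_opp_r m))|apply plus_zero_r]. }
rewrite E; etransitivity; [exact (scal_assoc (/ t) t h)|].
unfold mult; simpl; rewrite Rinv_l by exact Ht; exact (scal_one h).
Qed.

Section DirDerive.
Context {V : NormedModuleAux R_AbsRing}.

Lemma dir_derive_linear {W : NormedModuleAux R_AbsRing} (L : V -> W) (m h : V) :
  cont_linear L -> is_dir_derive L m h (L h).
Proof.
intros HL; unfold is_dir_derive.
apply (filterlim_ext_loc (fun _ => L h)); [|apply filterlim_const].
exists (mkposreal 1 Rlt_0_1); intros t _ Ht.
rewrite <- (cont_linear_minus L _ _ HL), <- (proj1 (proj2 HL)); f_equal.
symmetry; exact (module_diff_quotient m h t Ht).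
Qed.

Lemma dir_derive_comp {W : NormedModuleAux R_AbsRing} (Phi : circle_fun -> W)
    (F : V -> circle_fun) (m h : V) (l : circle_fun) :
  cont_linear (V := cf_NormedModuleAux) Phi -> is_dir_derive F m h l ->
  is_dir_derive (fun x => Phi (F x)) m h (Phi l).
Proof.
intros HP HF; unfold is_dir_derive.
eapply filterlim_ext; [|exact (filterlim_comp _ _ _ _ _ _ _ _ HF (proj2 (proj2 HP) l))].
intros t; simpl; rewrite (proj1 (proj2 HP)); f_equal.
exact (cont_linear_minus Phi _ _ HP).
Qed.

Lemma dir_derive_plus (F G : V -> circle_fun) (m h : V) (l l' : circle_fun) :
  is_dir_derive F m h l -> is_dir_derive G m h l' ->
  is_dir_derive (fun x => plus (F x) (G x)) m h (plus l l').
Proof.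
intros HF HG; unfold is_dir_derive in *.
eapply filterlim_ext; [|exact (cf_filterlim_plus _ _ _ _ _ HF HG)].
intros t; cf_ring.
Qed.

(** [F] at the displaced point is [F m] plus [t] times the difference quotient. The product rule
    needs this continuity, since it evaluates one factor at the displaced point. *)
Lemma dir_derive_filterlim (F : V -> circle_fun) (m h : V) (l : circle_fun) :
  is_dir_derive F m h l ->
  filterlim (fun t : R => F (plus m (scal t h))) (locally' 0) (locally (F m)).
Proof.
intros HF; unfold is_dir_derive in HF.
assert (H0 : filterlim (fun t : R => t) (locally' 0) (locally 0)).
{ apply (filterlim_filter_le_1 (F := locally 0)); [apply filter_le_within|apply filterlim_id]. }
pose proof (cf_filterlim_scal_0 _ _ _ _ H0 HF) as H1.
pose proof (cf_filterlim_plus _ _ _ _ _ (filterlim_const (F m)) H1) as H2.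
replace (F m) with (plus (F m) cf_zero) by exact (plus_zero_r (F m)).
revert H2; apply filterlim_ext_loc.
exists (mkposreal 1 Rlt_0_1); intros t _ Ht; apply circle_fun_ext; intros x; cf_expand; field; exact Ht.
Qed.

Lemma dir_derive_mult (F G : V -> circle_fun) (m h : V) (l l' : circle_fun) :
  is_dir_derive F m h l -> is_dir_derive G m h l' ->
  is_dir_derive (fun x => cf_mult (F x) (G x)) m h
    (plus (cf_mult l (G m)) (cf_mult (F m) l')).
Proof.
intros HF HG; pose proof (dir_derive_filterlim _ _ _ _ HG) as HGc.
unfold is_dir_derive in *.
eapply filterlim_ext; [|exact (cf_filterlim_plus _ _ _ _ _
  (cf_filterlim_mult _ _ _ _ _ HF HGc)
  (cf_filterlim_mult _ _ _ _ _ (filterlim_const (F m)) HG))].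
intros t; cf_ring.
Qed.

End DirDerive.

(** A class closed under differentiation: the derivative of a member on [V] is a member on [V * V].
    Hence [V] is an index ranging over all spaces, and iteration reaches every [class_C n]. *)
Inductive cf_poly : forall V : NormedModuleAux R_AbsRing, (V -> circle_fun) -> Prop :=
| cf_poly_linear (V : NormedModuleAux R_AbsRing) (L : V -> circle_fun) : cont_linear L -> cf_poly V L
| cf_poly_plus (V : NormedModuleAux R_AbsRing) (F G : V -> circle_fun) :
    cf_poly V F -> cf_poly V G -> cf_poly V (fun x => plus (F x) (G x))
| cf_poly_mult (V : NormedModuleAux R_AbsRing) (F G : V -> circle_fun) :
    cf_poly V F -> cf_poly V G -> cf_poly V (fun x => cf_mult (F x) (G x))
| cf_poly_comp (V : NormedModuleAux R_AbsRing) (F : V -> circle_fun) (L : circle_fun -> circle_fun) :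
    cf_poly V F -> cont_linear L -> cf_poly V (fun x => L (F x)).

Lemma cf_poly_precomp (U V : NormedModuleAux R_AbsRing) (F : V -> circle_fun) (L : U -> V) :
  cf_poly V F -> cont_linear L -> cf_poly U (fun x => F (L x)).
Proof.
intros HF; revert U L; induction HF as [V M HM|V F G _ IHF _ IHG|V F G _ IHF _ IHG|V F M _ IHF HM];
  intros U L HL.
- apply cf_poly_linear; exact (cont_linear_comp M L HM HL).
- apply (cf_poly_plus U (fun x => F (L x)) (fun x => G (L x))); auto.
- apply (cf_poly_mult U (fun x => F (L x)) (fun x => G (L x))); auto.
- apply (cf_poly_comp U (fun x => F (L x)) M); auto.
Qed.

Lemma cf_poly_continuous (V : NormedModuleAux R_AbsRing) (F : V -> circle_fun) (m : V) :
  cf_poly V F -> continuous F m.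
Proof.
intros HF; induction HF as [V M HM|V F G _ IHF _ IHG|V F G _ IHF _ IHG|V F M _ IHF HM].
- apply HM.
- exact (cf_filterlim_plus (locally m) F G _ _ (IHF m) (IHG m)).
- exact (cf_filterlim_mult (locally m) F G _ _ (IHF m) (IHG m)).
- apply (continuous_comp F M); [auto|apply HM].
Qed.

Lemma cf_poly_derive (V : NormedModuleAux R_AbsRing) (F : V -> circle_fun) :
  cf_poly V F ->
  exists dF : V * V -> circle_fun,
    (forall m h : V, is_dir_derive F m h (dF (m, h))) /\
    cf_poly (prod_NormedModuleAux R_AbsRing V V) dF.
Proof.
intros HF; induction HF as
  [V M HM|V F G _ [dF [HF PF]] _ [dG [HG PG]]
  |V F G HF' [dF [HF PF]] HG' [dG [HG PG]]|V F M _ [dF [HF PF]] HM].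
- exists (fun p => M (snd p)); split.
  + intros m h; apply dir_derive_linear, HM.
  + apply cf_poly_linear, (cont_linear_comp M), cont_linear_snd; exact HM.
- exists (fun p => plus (dF p) (dG p)); split.
  + intros m h; apply dir_derive_plus; auto.
  + apply cf_poly_plus; assumption.
- exists (fun p => plus (cf_mult (dF p) (G (fst p))) (cf_mult (F (fst p)) (dG p))); split.
  + intros m h; apply dir_derive_mult; auto.
  + apply cf_poly_plus; apply cf_poly_mult; try assumption;
      apply (cf_poly_precomp (prod_NormedModuleAux R_AbsRing V V) V _ fst);
      try assumption; apply cont_linear_fst.
- exists (fun p => M (dF p)); split.
  + intros m h; apply dir_derive_comp; auto.
  + apply cf_poly_comp; assumption.
Qed.

(** The outer [Phi] survives each differentiation unchanged, so real functionals such as the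
    integral of a polynomial map are covered too. *)
Lemma cf_poly_smooth (V W : NormedModuleAux R_AbsRing) (F : V -> circle_fun)
    (Phi : circle_fun -> W) :
  cf_poly V F -> cont_linear (V := cf_NormedModuleAux) Phi -> smooth_map (fun x => Phi (F x)).
Proof.
intros HF HP n; revert V F HF; induction n as [|n IH]; intros V F HF.
- intros m; apply (continuous_comp F Phi); [apply cf_poly_continuous, HF|apply HP].
- split.
  + intros m; apply (continuous_comp F Phi); [apply cf_poly_continuous, HF|apply HP].
  + destruct (cf_poly_derive V F HF) as [dF [H1 H2]].
    exists (fun p => Phi (dF p)); split.
    * intros m h; apply dir_derive_comp; auto.
    * apply IH; exact H2.
Qed.

(** * The operator [aI + bD^2] *)

(* The Green kernel of [D^2 + kappa] on the circle: the periodic extension of [G]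
   solves the homogeneous equation except for a unit jump of [G'] at the origin. *)
Lemma green_kernel (kappa : R) :
  (forall n : Z, kappa <> IZR n ^ 2) ->
  exists G G1 : R -> R,
    (forall x, is_derive G x (G1 x)) /\ (forall x, is_derive G1 x (- kappa * G x)) /\
    G (2 * PI) = G 0 /\ G1 (2 * PI) - G1 0 = -1.
Proof.
intros Hk; pose proof PI_RGT_0 as HPI.
destruct (Rtotal_order kappa 0) as [H|[H|H]].
- set (w := sqrt (- kappa)).
  assert (Hw : 0 < w) by (apply sqrt_lt_R0; lra).
  assert (Hw2 : - kappa = w * w) by (unfold w; rewrite sqrt_sqrt; lra).
  assert (He : exp (- (w * PI)) < exp (w * PI)) by (apply exp_increasing; nra).
  set (K := - / (2 * w * (exp (w * PI) - exp (- (w * PI))))).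
  (* Even about [PI], so the values of [G] at [0] and [2 * PI] agree; [K] normalizes the jump of
     [G1]. *)
  exists (fun y => K * (exp (w * (y - PI)) + exp (- (w * (y - PI))))).
  exists (fun y => K * w * (exp (w * (y - PI)) - exp (- (w * (y - PI))))).
  refine (conj _ (conj _ (conj _ _))).
  + intros x; auto_derive; [trivial|unfold Rminus; ring].
  + intros x; rewrite Hw2; auto_derive; [trivial|unfold Rminus; ring].
  + replace (w * (2 * PI - PI)) with (w * PI) by ring.
    replace (w * (0 - PI)) with (- (w * PI)) by ring; rewrite Ropp_involutive; ring.
  + replace (w * (2 * PI - PI)) with (w * PI) by ring.
    replace (w * (0 - PI)) with (- (w * PI)) by ring; rewrite Ropp_involutive.
    unfold K; field; split; lra.
- exfalso; apply (Hk 0%Z); rewrite H; ring.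
- set (w := sqrt kappa).
  assert (Hw : 0 < w) by (apply sqrt_lt_R0; lra).
  assert (Hw2 : kappa = w * w) by (unfold w; rewrite sqrt_sqrt; lra).
  (* The denominator of [K] vanishes only at resonance, when [w] is an integer and [kappa] its
     square. *)
  assert (Hs : sin (w * PI) <> 0).
  { intros Hs; destruct (sin_eq_0_0 _ Hs) as [k E].
    apply (Hk k); rewrite Hw2; replace w with (IZR k); [ring|].
    apply (Rmult_eq_reg_r PI); lra. }
  set (K := / (2 * w * sin (w * PI))).
  exists (fun y => K * cos (w * (y - PI))), (fun y => - K * w * sin (w * (y - PI))).
  refine (conj _ (conj _ (conj _ _))).
  + intros x; auto_derive; [trivial|unfold Rminus; ring].
  + intros x; rewrite Hw2; auto_derive; [trivial|unfold Rminus; ring].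
  + replace (w * (2 * PI - PI)) with (w * PI) by ring.
    replace (w * (0 - PI)) with (- (w * PI)) by ring; now rewrite cos_neg.
  + replace (w * (2 * PI - PI)) with (w * PI) by ring.
    replace (w * (0 - PI)) with (- (w * PI)) by ring; rewrite sin_neg.
    unfold K; field; split; lra.
Qed.

(** * Convolution with a kernel on the circle *)

Section Convolution.
Variables (G : R -> R) (HG : forall x, continuous G x).

Lemma continuous_shift (f : circle_fun) (x y : R) :
  continuous (fun t => f (x + t)) y.
Proof.
apply (continuous_comp (fun t => x + t) f); [|apply cf_continuous].
apply (continuous_plus (V := R_NormedModule)); [apply continuous_const|apply continuous_id].
Qed.

Lemma ex_RInt_conv (f : circle_fun) (x a b : R) : ex_RInt (fun y => G y * f (x + y)) a b.
Proof.
apply (ex_RInt_continuous (V := R_CompleteNormedModule)); intros y _.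
apply (continuous_mult (K := R_AbsRing)); [apply HG|apply continuous_shift].
Qed.

(** The argument [x + y] puts all dependence on [x] into [f]: the result is smooth and periodic
    although [G] is merely continuous and is not made periodic. *)
Definition conv_raw (f : circle_fun) (x : R) : R :=
  RInt (fun y => G y * f (x + y)) 0 (2 * PI).

Lemma ex_derive_shift (f : circle_fun) (x t : R) : ex_derive (fun u => f (u + t)) x.
Proof. apply (ex_derive_comp f (fun u => u + t)); [apply cf_ex_derive|auto_derive; trivial]. Qed.

Lemma Derive_shift (f : circle_fun) (x t : R) : Derive (fun u => f (u + t)) x = cf_D f (x + t).
Proof.
rewrite (Derive_comp f (fun u => u + t)); [|apply cf_ex_derive|auto_derive; trivial].
replace (Derive (fun u => u + t) x) with 1; [simpl; ring|].
symmetry; apply is_derive_unique; auto_derive; [trivial|unfold Rminus; ring].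
Qed.

Lemma is_derive_conv_raw (f : circle_fun) (x : R) :
  is_derive (conv_raw f) x (conv_raw (cf_D f) x).
Proof.
assert (E : forall t u, Derive (fun u => G t * f (u + t)) u = G t * cf_D f (u + t)).
{ intros t u; rewrite (Derive_scal (fun u => f (u + t))), Derive_shift; reflexivity. }
unfold conv_raw.
rewrite (RInt_ext _ (fun t => Derive (fun u => G t * f (u + t)) x)) by (intros; now rewrite E).
apply (is_derive_RInt_param (fun u t => G t * f (u + t))).
- exists (mkposreal 1 Rlt_0_1); intros y _ t _.
  apply (ex_derive_scal (fun u => f (u + t))), ex_derive_shift.
- intros t _.
  apply (continuity_2d_pt_ext (fun u v => G v * cf_D f (u + v))); [intros; now rewrite E|].
  apply continuity_2d_pt_mult.
  + apply (continuity_1d_2d_pt_comp G (fun _ v => v)).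
    * apply continuity_pt_filterlim, HG.
    * apply continuity_2d_pt_id2.
  + apply (continuity_1d_2d_pt_comp (cf_D f) (fun u v => u + v)).
    * apply continuity_pt_filterlim, (cf_continuous (cf_D f)).
    * apply continuity_2d_pt_plus; [apply continuity_2d_pt_id1|apply continuity_2d_pt_id2].
- exists (mkposreal 1 Rlt_0_1); intros y _; apply ex_RInt_conv.
Qed.

Lemma Derive_conv_raw (f : circle_fun) (x : R) :
  Derive (conv_raw f) x = conv_raw (cf_D f) x.
Proof. apply is_derive_unique, is_derive_conv_raw. Qed.

Lemma conv_raw_smooth (n : nat) : forall (f : circle_fun) x, ex_derive_n (conv_raw f) n x.
Proof.
induction n as [|n IH]; intros f; [intros; exact I|].
apply smooth_of_Derive.
- intros x; eexists; apply is_derive_conv_raw.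
- intros x; apply (ex_derive_n_ext (conv_raw (cf_D f))); [|apply IH].
  intros t; symmetry; apply Derive_conv_raw.
Qed.

Lemma conv_raw_periodic (f : circle_fun) (x : R) : conv_raw f (x + 2 * PI) = conv_raw f x.
Proof.
unfold conv_raw; apply RInt_ext; intros y _.
replace (x + 2 * PI + y) with (x + y + 2 * PI) by ring; now rewrite cfun_periodic.
Qed.

Definition conv (f : circle_fun) : circle_fun :=
  CircleFun (conv_raw f) (conv_raw_periodic f) (fun n x => conv_raw_smooth n f x).

Lemma conv_D (f : circle_fun) : cf_D (conv f) = conv (cf_D f).
Proof. apply circle_fun_ext; exact (Derive_conv_raw f). Qed.

Lemma conv_plus (f g : circle_fun) : conv (plus f g) = plus (conv f) (conv g).
Proof.
apply circle_fun_ext; intros x; simpl; unfold conv_raw.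
rewrite <- (RInt_plus (V := R_CompleteNormedModule)) by apply ex_RInt_conv.
apply RInt_ext; intros y _; rewrite cf_plusE; unfold plus; simpl; ring.
Qed.

Lemma conv_scal (c : R) (f : circle_fun) : conv (scal c f) = scal c (conv f).
Proof.
apply circle_fun_ext; intros x; simpl; unfold conv_raw.
etransitivity; [|apply (RInt_scal (V := R_CompleteNormedModule)), ex_RInt_conv].
apply RInt_ext; intros y _; rewrite cf_scalE; unfold scal; simpl; unfold mult; simpl; ring.
Qed.

Lemma conv_cont_linear : cont_linear conv.
Proof.
pose proof PI_RGT_0 as HPI.
destruct (bounded_continuity (V := R_NormedModule) G 0 (2 * PI)) as [M HM].
{ intros x _; apply HG. }
assert (HM0 : 0 < M).
{ apply Rle_lt_trans with (1 := Rabs_pos (G 0)); apply (HM 0); lra. }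
apply (cont_linear_bounded _ (2 * PI * M)).
- exact conv_plus.
- exact conv_scal.
- exact conv_D.
- nra.
- intros u N Hu x.
  replace (2 * PI * M * N) with ((2 * PI - 0) * (M * N)) by ring.
  apply (norm_RInt_le_const (V := R_NormedModule) (fun y => G y * u (x + y)) 0 (2 * PI)); [lra| |].
  + intros y Hy; change (Rabs (G y * u (x + y)) <= M * N); rewrite Rabs_mult.
    apply Rmult_le_compat; auto using Rabs_pos; left; apply (HM y Hy).
  + apply (RInt_correct (V := R_CompleteNormedModule)), ex_RInt_conv.
Qed.

End Convolution.

(** Convolution with the Green kernel is computed only as a left inverse; it commutes with [D], so
    it is a right inverse as well. *)
Lemma D2_iso (kappa : R) :
  (forall n : Z, kappa <> IZR n ^ 2) ->
  exists T : circle_fun -> circle_fun, cont_linear T /\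
    forall f, plus (cf_D (cf_D (T f))) (scal kappa (T f)) = f /\
              T (plus (cf_D (cf_D f)) (scal kappa f)) = f.
Proof.
intros Hk; destruct (green_kernel kappa Hk) as [G [G1 [HG [HG1 [Hp Hj]]]]].
assert (CG : forall x, continuous G x).
{ intros x; apply (ex_derive_continuous (V := R_NormedModule)); eexists; apply HG. }
exists (conv G CG); split; [apply conv_cont_linear|].
assert (H : forall f, conv G CG (plus (cf_D (cf_D f)) (scal kappa f)) = f).
{ intros f; apply circle_fun_ext; intros x; simpl; unfold conv_raw.
  (* Lagrange's identity: [W] is a primitive of the integrand, and its boundary terms reduce to
     [f x] through the jump of [G1]. *)
  set (W := fun y => G y * cf_D f (x + y) - G1 y * f (x + y)).
  transitivity (W (2 * PI) - W 0).
  - apply (is_RInt_unique (V := R_CompleteNormedModule)).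
    apply (is_RInt_derive (V := R_CompleteNormedModule) W).
    + intros y _; unfold W.
      assert (S : forall g : circle_fun, is_derive (fun y => g (x + y)) y (cf_D g (x + y))).
      { intros g; apply (is_derive_ext (fun y => g (y + x))); [intros; f_equal; ring|].
        rewrite (Rplus_comm x y), <- Derive_shift; apply Derive_correct, ex_derive_shift. }
      evar_last; [apply (is_derive_minus (K := R_AbsRing) (V := R_NormedModule));
        apply (is_derive_mult (K := R_AbsRing)); [apply HG|apply S| |apply HG1|apply S|]; exact Rmult_comm|].
      rewrite cf_plusE, cf_scalE; unfold minus, plus, opp, mult; simpl; ring.
    + intros y _; apply (continuous_mult (K := R_AbsRing)); [apply CG|apply continuous_shift].
  - unfold W; rewrite Rplus_0_r, !cfun_periodic, Hp.
    replace (G1 (2 * PI)) with (G1 0 - 1) by lra; ring. }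
intros f; split; [|exact (H f)].
rewrite !conv_D, <- conv_scal, <- conv_plus; apply H.
Qed.

Lemma aI_bD2_iso (a b : R) :
  (forall n : Z, a - b * IZR n ^ 2 <> 0) ->
  exists Ainv, continuous_linear_iso (aI_bD2 a b) Ainv.
Proof.
intros Hab.
assert (HA : cont_linear (aI_bD2 a b)).
{ apply (cont_linear_plus (fun u => scal a u) (fun u => scal b (cf_D (cf_D u)))).
  - apply cont_linear_scal.
  - apply (cont_linear_comp (U := cf_NormedModuleAux) (V := cf_NormedModuleAux) (W := cf_NormedModuleAux)
      (fun u => scal b u)); [apply cont_linear_scal|].
    apply (cont_linear_comp (U := cf_NormedModuleAux) (V := cf_NormedModuleAux) (W := cf_NormedModuleAux)
      cf_D cf_D); apply cont_linear_D. }
destruct (Req_dec b 0) as [Hb|Hb].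
- assert (Ha : a <> 0) by (intros Ha; apply (Hab 0%Z); rewrite Ha, Hb; ring).
  exists (fun u => scal (/ a) u); split; [exact HA|split; [exact (cont_linear_scal (/ a))|]].
  subst b; split; intros u; apply circle_fun_ext; intros x; cf_expand; field; exact Ha.
- destruct (D2_iso (a / b)) as [T [HT HT']].
  { intros n E; apply (Hab n); rewrite <- E; field; exact Hb. }
  exists (fun u => scal (/ b) (T u)); split; [exact HA|split].
  { apply (cont_linear_comp (U := cf_NormedModuleAux) (V := cf_NormedModuleAux) (W := cf_NormedModuleAux)
      (fun u => scal (/ b) u) T); [apply cont_linear_scal|exact HT]. }
  split; intros u.
  + rewrite <- (proj1 (proj2 HT)).
    transitivity (T (plus (cf_D (cf_D u)) (scal (a / b) u))); [|apply HT'].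
    f_equal; apply circle_fun_ext; intros x; cf_expand; field; exact Hb.
  + rewrite <- (proj1 (HT' u)) at 2.
    apply circle_fun_ext; intros x; cf_expand; field; exact Hb.
Qed.

Lemma aI_bD2_const_coeff (a b : R) : const_coeff_diff_operator (aI_bD2 a b).
Proof.
exists 2%nat, (fun k => match k with 0%nat => a | 2%nat => b | _ => 0 end).
intros u; apply circle_fun_ext; intros x.
rewrite !sum_Sn, sum_O; simpl; cf_expand; ring.
Qed.

Lemma aI_bD2_symmetric (a b : R) : L2_symmetric (aI_bD2 a b).
Proof.
intros u v; unfold aI_bD2.
rewrite L2_plus_l, L2_plus_r, !L2_scal_l, !L2_scal_r, !L2_D, <- L2_D, L2_D; ring.
Qed.

(** [D] is a coboundary and [D ^ 3] the Gelfand-Fuchs cocycle. In the cyclic sum the terms with [a]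
    cancel pointwise, and those with [b] form the derivative of [b] times the cyclic sum of [[u, v]
    w'']. *)
Lemma aD_bD3_cocycle (a b : R) : local_cocycle (aD_bD3 a b).
Proof.
split; [|split].
- set (cst := fun c => scal c (CircleFun (fun _ => 1) (fun _ => eq_refl)
    (smooth_ext _ _ (fun _ => eq_refl) (fun n x => ex_derive_n_const 1 n x)))).
  exists 3%nat, (fun k => match k with 1%nat => cst a | 3%nat => cst b | _ => cst 0 end).
  intros u; apply circle_fun_ext; intros x.
  rewrite !sum_Sn, sum_O; simpl; cf_expand; simpl; ring.
- intros u v; unfold aD_bD3.
  rewrite L2_plus_l, L2_plus_r, !L2_scal_l, !L2_scal_r, !L2_D; ring.
- intros u v w; simpl; rewrite !L2_int, <- !cf_int_plus.
  rewrite <- (cf_int_D (scal b (plus (plus (cf_mult (bracket u v) (cf_D (cf_D w)))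
    (cf_mult (bracket v w) (cf_D (cf_D u)))) (cf_mult (bracket w u) (cf_D (cf_D v)))))).
  f_equal; cf_ring.
Qed.

(** * The cubic Hamiltonian and its gradient *)

Section CubicHamiltonian.
Variables (a b : R) (Ainv : circle_fun -> circle_fun).
Hypothesis HA : continuous_linear_iso (aI_bD2 a b) Ainv.

Definition H3_poly (m : circle_fun) : circle_fun :=
  let u := Ainv m in
  plus (scal a (cf_mult u (cf_mult u u)))
       (scal (- b) (cf_mult u (cf_mult (cf_D u) (cf_D u)))).

(** The argument of the outer [Ainv] is the Euler-Lagrange expression of the functional in [u]; the
    chain rule for [u = Ainv m] then contributes [Ainv], which is symmetric. *)
Definition H3_gradient (m : circle_fun) : circle_fun :=
  let u := Ainv m in
  Ainv (scal (1 / 2) (plus (scal (3 * a) (cf_mult u u))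
    (plus (scal b (cf_mult (cf_D u) (cf_D u))) (scal (2 * b) (cf_mult u (cf_D (cf_D u))))))).

Let HI : cont_linear Ainv.
Proof. exact (proj1 (proj2 HA)). Qed.

Let HID : cont_linear (fun m => cf_D (Ainv m)).
Proof.
apply (cont_linear_comp (U := cf_NormedModuleAux) (V := cf_NormedModuleAux) (W := cf_NormedModuleAux)
  cf_D Ainv); [apply cont_linear_D|exact HI].
Qed.

Lemma H3_eq (m : circle_fun) : H3 a b Ainv m = 1 / 2 * cf_int (H3_poly m).
Proof.
unfold H3; f_equal; apply RInt_ext; intros x _; unfold H3_poly; cf_expand; simpl; ring.
Qed.

Lemma cont_linear_half_int :
  cont_linear (V := cf_NormedModuleAux) (W := R_NormedModuleAux) (fun u => 1 / 2 * cf_int u).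
Proof.
assert (H : cont_linear (V := cf_NormedModuleAux) (W := R_NormedModuleAux)
  (fun u => cf_int (scal (1 / 2) u))).
{ apply (cont_linear_comp (U := cf_NormedModuleAux) (V := cf_NormedModuleAux) (W := R_NormedModuleAux)
    cf_int); [apply cont_linear_int|apply cont_linear_scal]. }
assert (E : (fun u : circle_fun => 1 / 2 * cf_int u) = (fun u => cf_int (scal (1 / 2) u))).
{ apply functional_extensionality; intros u; symmetry; apply cf_int_scal. }
exact (eq_ind_r (cont_linear (V := cf_NormedModuleAux) (W := R_NormedModuleAux)) H E).
Qed.

Lemma H3_fun_eq : H3 a b Ainv = fun m => 1 / 2 * cf_int (H3_poly m).
Proof. apply functional_extensionality, H3_eq. Qed.

Lemma H3_regular : regular (H3 a b Ainv) H3_gradient.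
Proof.
assert (PI0 : cf_poly cf_NormedModuleAux Ainv) by (apply cf_poly_linear, HI).
assert (PID : cf_poly cf_NormedModuleAux (fun m => cf_D (Ainv m))) by (apply cf_poly_linear, HID).
split; [|split].
- rewrite H3_fun_eq.
  apply (cf_poly_smooth cf_NormedModuleAux R_NormedModuleAux H3_poly (fun u => 1 / 2 * cf_int u));
    [|apply cont_linear_half_int].
  unfold H3_poly; simpl; repeat first [assumption
    | apply (cf_poly_plus cf_NormedModuleAux)
    | apply (cf_poly_mult cf_NormedModuleAux)
    | refine (cf_poly_comp cf_NormedModuleAux _ (fun u => scal _ u) _ (cont_linear_scal _)) ].
- apply (cf_poly_smooth cf_NormedModuleAux cf_NormedModuleAux H3_gradient (fun u => u));
    [|apply cont_linear_id].
  unfold H3_gradient; simpl.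
  refine (cf_poly_comp cf_NormedModuleAux _ Ainv _ HI).
  repeat first [assumption
    | apply (cf_poly_plus cf_NormedModuleAux)
    | apply (cf_poly_mult cf_NormedModuleAux)
    | refine (cf_poly_comp cf_NormedModuleAux _ (fun u => scal _ u) _ (cont_linear_scal _))
    | refine (cf_poly_comp cf_NormedModuleAux _ cf_D _ cont_linear_D) ].
- intros m M; rewrite H3_fun_eq.
  pose proof (dir_derive_linear (V := cf_NormedModuleAux) (W := cf_NormedModuleAux) Ainv m M HI) as D0.
  pose proof (dir_derive_linear (V := cf_NormedModuleAux) (W := cf_NormedModuleAux) _ m M HID) as D1.
  pose proof (dir_derive_mult _ _ _ _ _ _ D0 (dir_derive_mult _ _ _ _ _ _ D0 D0)) as E1.
  pose proof (dir_derive_mult _ _ _ _ _ _ D0 (dir_derive_mult _ _ _ _ _ _ D1 D1)) as E2.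
  pose proof (dir_derive_plus _ _ _ _ _ _
    (dir_derive_comp (W := cf_NormedModuleAux) (fun u => scal a u) _ _ _ _ (cont_linear_scal a) E1)
    (dir_derive_comp (W := cf_NormedModuleAux) (fun u => scal (- b) u) _ _ _ _ (cont_linear_scal (- b)) E2)) as E3.
  pose proof (dir_derive_comp (W := R_NormedModuleAux) _ _ _ _ _ cont_linear_half_int E3) as E4.
  replace (L2 M (H3_gradient m)) with
    (1 / 2 * cf_int (plus
      (scal a (plus (cf_mult (Ainv M) (cf_mult (Ainv m) (Ainv m)))
        (cf_mult (Ainv m) (plus (cf_mult (Ainv M) (Ainv m)) (cf_mult (Ainv m) (Ainv M))))))
      (scal (- b) (plus (cf_mult (Ainv M) (cf_mult (cf_D (Ainv m)) (cf_D (Ainv m))))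
        (cf_mult (Ainv m) (plus (cf_mult (cf_D (Ainv M)) (cf_D (Ainv m)))
          (cf_mult (cf_D (Ainv m)) (cf_D (Ainv M))))))))); [exact E4|].
  unfold H3_gradient; destruct HA as [_ [_ [_ HAI]]].
  rewrite <- (symmetric_inverse _ _ _ _ (aI_bD2_symmetric a b) HAI), L2_int, <- cf_int_scal.
  (* This primitive moves the derivative off [Ainv M]. *)
  apply (cf_int_parts (scal (- b) (cf_mult (Ainv m) (cf_mult (cf_D (Ainv m)) (Ainv M))))).
  intros x; cf_expand; field.
Qed.

(** [Q = D A] cancels the outer [Ainv] of the gradient, so both sides become differential
    polynomials in [u = Ainv m]. *)
Lemma H3_euler_field (m : circle_fun) :
  euler_field Ainv m = aD_bD3 a b (H3_gradient m).
Proof.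
destruct HA as [_ [_ [_ HAI]]].
transitivity (cf_D (aI_bD2 a b (H3_gradient m))); [|cf_ring].
unfold H3_gradient; rewrite HAI; unfold euler_field.
rewrite <- (HAI m) at 1.
apply circle_fun_ext; intros x; cf_expand; field.
Qed.

End CubicHamiltonian.

Lemma aI_bD2_bi_hamiltonian (a b : R) :
  (forall n : Z, a - b * IZR n ^ 2 <> 0) ->
  exists Ainv : circle_fun -> circle_fun,
    const_coeff_diff_operator (aI_bD2 a b) /\
    L2_symmetric (aI_bD2 a b) /\
    continuous_linear_iso (aI_bD2 a b) Ainv /\
    (forall u : circle_fun, cf_D (aI_bD2 a b u) = aD_bD3 a b u) /\
    second_hamiltonian (aD_bD3 a b) (H3 a b Ainv) (euler_field Ainv).
Proof.
intros Hab; destruct (aI_bD2_iso a b Hab) as [Ainv HA]; exists Ainv.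
split; [apply aI_bD2_const_coeff|]; split; [apply aI_bD2_symmetric|].
split; [exact HA|]; split; [intros u; cf_ring|]; split; [apply aD_bD3_cocycle|].
exists (H3_gradient a b Ainv); split; [apply H3_regular, HA|apply H3_euler_field, HA].
Qed.

(** * Fourier modes *)

Definition pol (N : nat) (d : nat -> R) (x : R) : R := sum_n (fun k => d k * x ^ k) N.

Lemma pol_S (N : nat) (d : nat -> R) (x : R) :
  pol (S N) d x = d 0%nat + x * pol N (fun k => d (S k)) x.
Proof.
unfold pol; induction N as [|N IH].
- rewrite sum_Sn, !sum_O; unfold plus; simpl; ring.
- rewrite sum_Sn, IH, (sum_Sn _ N); unfold plus; simpl; ring.
Qed.

Lemma pol_const (N : nat) (d : nat -> R) (x : R) :
  (forall k, (1 <= k <= N)%nat -> d k = 0) -> pol N d x = d 0%nat.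
Proof.
intros H; unfold pol; induction N as [|N IH]; [rewrite sum_O; simpl; ring|].
rewrite sum_Sn, IH by (intros; apply H; lia); rewrite (H (S N)) by lia.
unfold plus; simpl; ring.
Qed.

(** Induction by Horner's step: if the inner polynomial is constant, the outer one is constant or of
    linear growth; if it is large, multiplication by [x] keeps it large. No degree has to be
    named. *)
Lemma pol_const_or_large (N : nat) : forall d,
  (forall k, (1 <= k <= N)%nat -> d k = 0) \/
  forall M, exists X, forall x, X <= x -> M <= Rabs (pol N d x).
Proof.
induction N as [|N IH]; intros d; [left; lia|].
assert (T : forall x, Rabs x * Rabs (pol N (fun k => d (S k)) x) <=
                      Rabs (pol (S N) d x) + Rabs (d 0%nat)).
{ intros x; rewrite pol_S, <- Rabs_mult.
  set (y := x * _); clearbody y; unfold Rabs; repeat destruct Rcase_abs; lra. }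
destruct (IH (fun k => d (S k))) as [H|H].
- destruct (Req_dec (d 1%nat) 0) as [H1|H1].
  + left; intros [|[|k]] Hk; [lia|exact H1|apply H; lia].
  + right; intros M; exists (Rmax 0 ((M + Rabs (d 0%nat)) / Rabs (d 1%nat))); intros x Hx.
    assert (Hd : 0 < Rabs (d 1%nat)) by now apply Rabs_pos_lt.
    specialize (T x); rewrite (pol_const N _ x H) in T.
    pose proof (Rle_trans _ _ _ (Rmax_l _ _) Hx) as X0.
    pose proof (Rle_trans _ _ _ (Rmax_r _ _) Hx) as X1.
    rewrite (Rabs_pos_eq x X0) in T.
    apply (Rmult_le_compat_r (Rabs (d 1%nat))) in X1; [|lra].
    replace ((M + Rabs (d 0%nat)) / Rabs (d 1%nat) * Rabs (d 1%nat))
      with (M + Rabs (d 0%nat)) in X1 by (field; lra); lra.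
- right; intros M; destruct (H (Rabs M + Rabs (d 0%nat))) as [X HX].
  exists (Rmax 1 X); intros x Hx.
  pose proof (Rle_trans _ _ _ (Rmax_l _ _) Hx) as X0.
  specialize (HX x (Rle_trans _ _ _ (Rmax_r _ _) Hx)).
  specialize (T x); rewrite (Rabs_pos_eq x) in T by lra.
  pose proof (Rle_abs M); pose proof (Rabs_pos (pol N (fun k => d (S k)) x)); nra.
Qed.

(** The inner polynomial of Horner's step has constant term [d 1 = 0]; unless it vanishes it is not
    constant, hence unbounded, and the factor [x] adds the linear growth. *)
Lemma pol_superlinear (N : nat) (d : nat -> R) :
  d 1%nat = 0 ->
  (forall k, (1 <= k <= N)%nat -> d k = 0) \/
  forall M, exists X, forall x, X <= x -> M * x <= Rabs (pol N d x).
Proof.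
intros H1; destruct N as [|N]; [left; lia|].
destruct (pol_const_or_large N (fun k => d (S k))) as [H|H].
- left; intros [|[|k]] Hk; [lia|exact H1|apply H; lia].
- right; intros M; destruct (H (M + Rabs (d 0%nat))) as [X HX].
  exists (Rmax 1 X); intros x Hx.
  pose proof (Rle_trans _ _ _ (Rmax_l _ _) Hx) as X0.
  specialize (HX x (Rle_trans _ _ _ (Rmax_r _ _) Hx)).
  assert (T : Rabs x * Rabs (pol N (fun k => d (S k)) x) <=
              Rabs (pol (S N) d x) + Rabs (d 0%nat)).
  { rewrite pol_S, <- Rabs_mult.
    set (y := x * _); clearbody y; unfold Rabs; repeat destruct Rcase_abs; lra. }
  rewrite (Rabs_pos_eq x) in T by lra.
  pose proof (Rabs_pos (d 0%nat)); nra.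
Qed.

Lemma Z_above (n : Z) (X : R) : exists m, (n <= m)%Z /\ X <= IZR m.
Proof.
exists (Z.max n (up X)); split; [apply Z.le_max_l|].
apply Rle_trans with (IZR (up X)); [left; apply archimed|apply IZR_le, Z.le_max_r].
Qed.

Lemma pol_zero (N : nat) (d : nat -> R) (n0 : Z) :
  (forall n, (n0 <= n)%Z -> pol N d (IZR n) = 0) -> forall k, (k <= N)%nat -> d k = 0.
Proof.
intros H; destruct (pol_const_or_large N d) as [Hc|Hl].
- intros [|k] Hk; [|apply Hc; lia].
  rewrite <- (H n0 (Z.le_refl _)); symmetry; now apply pol_const.
- destruct (Hl 1) as [X HX]; destruct (Z_above n0 X) as [m [Hm1 Hm2]].
  specialize (HX _ Hm2); rewrite H, Rabs_R0 in HX by exact Hm1; lra.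
Qed.

Lemma sum_n_support {G : AbelianMonoid} (f : nat -> G) (N M : nat) :
  (forall k, (N < k)%nat -> f k = zero) -> (N <= M)%nat -> sum_n f M = sum_n f N.
Proof.
intros H HM; induction HM as [|M HM IH]; [reflexivity|].
rewrite sum_Sn, IH, H by lia; apply plus_zero_r.
Qed.

(** * Trigonometric modes *)

Lemma smooth_trig (w : R) (k : nat) :
  (forall x, ex_derive_n (fun t => cos (w * t)) k x) /\
  (forall x, ex_derive_n (fun t => sin (w * t)) k x).
Proof.
induction k as [|k [IHc IHs]]; [split; intros; exact I|split].
- apply smooth_of_Derive.
  + intros x; auto_derive; trivial.
  + intros x; apply (ex_derive_n_ext (fun t => - w * sin (w * t))).
    * intros t; symmetry; apply is_derive_unique; auto_derive; [trivial|ring].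
    * apply ex_derive_n_scal_l, IHs.
- apply smooth_of_Derive.
  + intros x; auto_derive; trivial.
  + intros x; apply (ex_derive_n_ext (fun t => w * cos (w * t))).
    * intros t; symmetry; apply is_derive_unique; auto_derive; [trivial|ring].
    * apply ex_derive_n_scal_l, IHc.
Qed.

Lemma trig_period_Z (n : Z) (y : R) :
  cos (y + 2 * IZR n * PI) = cos y /\ sin (y + 2 * IZR n * PI) = sin y.
Proof.
destruct (Z_le_dec 0 n) as [Hn|Hn].
- rewrite <- (Z2Nat.id n Hn), <- INR_IZR_INZ; split; [apply cos_period|apply sin_period].
- replace (IZR n) with (- INR (Z.to_nat (- n))).
  2:{ rewrite INR_IZR_INZ, Z2Nat.id, opp_IZR by lia; ring. }
  set (k := Z.to_nat (- n)); set (z := y + 2 * - INR k * PI).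
  replace y with (z + 2 * INR k * PI) by (unfold z; ring).
  split; symmetry; [apply cos_period|apply sin_period].
Qed.

Program Definition tc (n : Z) : circle_fun := CircleFun (fun x => cos (IZR n * x)) _ _.
Next Obligation.
replace (IZR n * (x + 2 * PI)) with (IZR n * x + 2 * IZR n * PI) by ring; apply trig_period_Z.
Qed.
Next Obligation. exact (proj1 (smooth_trig (IZR n) n0) x). Qed.

Program Definition ts (n : Z) : circle_fun := CircleFun (fun x => sin (IZR n * x)) _ _.
Next Obligation.
replace (IZR n * (x + 2 * PI)) with (IZR n * x + 2 * IZR n * PI) by ring; apply trig_period_Z.
Qed.
Next Obligation. exact (proj2 (smooth_trig (IZR n) n0) x). Qed.

Lemma D_tc (n : Z) : cf_D (tc n) = scal (- IZR n) (ts n).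
Proof.
apply circle_fun_ext; intros x; rewrite cf_scalE; simpl.
apply is_derive_unique; auto_derive; [trivial|ring].
Qed.

Lemma D_ts (n : Z) : cf_D (ts n) = scal (IZR n) (tc n).
Proof.
apply circle_fun_ext; intros x; rewrite cf_scalE; simpl.
apply is_derive_unique; auto_derive; [trivial|ring].
Qed.

Lemma tc_opp (n : Z) : tc (- n) = tc n.
Proof.
apply circle_fun_ext; intros x; simpl.
rewrite opp_IZR, Ropp_mult_distr_l_reverse; apply cos_neg.
Qed.

Lemma ts_opp (n : Z) : ts (- n) = scal (-1) (ts n).
Proof.
apply circle_fun_ext; intros x; rewrite cf_scalE; simpl.
rewrite opp_IZR, Ropp_mult_distr_l_reverse, sin_neg; ring.
Qed.

Lemma tc_0E (x : R) : tc 0 x = 1.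
Proof. simpl; rewrite Rmult_0_l; apply cos_0. Qed.

Lemma tc_tc (a b : Z) :
  cf_mult (tc a) (tc b) = plus (scal (/ 2) (tc (a + b))) (scal (/ 2) (tc (a - b))).
Proof.
apply circle_fun_ext; intros x; cf_expand; simpl.
rewrite plus_IZR, minus_IZR, Rmult_plus_distr_r, Rmult_minus_distr_r, cos_plus, cos_minus; field.
Qed.

Lemma ts_ts (a b : Z) :
  cf_mult (ts a) (ts b) = plus (scal (/ 2) (tc (a - b))) (scal (- / 2) (tc (a + b))).
Proof.
apply circle_fun_ext; intros x; cf_expand; simpl.
rewrite plus_IZR, minus_IZR, Rmult_plus_distr_r, Rmult_minus_distr_r, cos_plus, cos_minus; field.
Qed.

Lemma ts_tc (a b : Z) :
  cf_mult (ts a) (tc b) = plus (scal (/ 2) (ts (a + b))) (scal (/ 2) (ts (a - b))).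
Proof.
apply circle_fun_ext; intros x; cf_expand; simpl.
rewrite plus_IZR, minus_IZR, Rmult_plus_distr_r, Rmult_minus_distr_r, sin_plus, sin_minus; field.
Qed.

Lemma tc_ts (a b : Z) :
  cf_mult (tc a) (ts b) = plus (scal (/ 2) (ts (a + b))) (scal (- / 2) (ts (a - b))).
Proof.
apply circle_fun_ext; intros x; cf_expand; simpl.
rewrite plus_IZR, minus_IZR, Rmult_plus_distr_r, Rmult_minus_distr_r, sin_plus, sin_minus; field.
Qed.

Lemma cf_int_tc (n : Z) : n <> 0%Z -> cf_int (tc n) = 0.
Proof.
intros Hn; rewrite <- (cf_int_D (scal (/ IZR n) (ts n))), cf_D_scal, D_ts; f_equal.
apply circle_fun_ext; intros x; cf_expand; field; apply not_0_IZR, Hn.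
Qed.

Lemma cf_int_tc_0 : cf_int (tc 0) = 2 * PI.
Proof.
unfold cf_int; rewrite (RInt_ext _ (fun _ => 1)) by (intros; apply tc_0E).
rewrite RInt_const; unfold scal; simpl; unfold mult; simpl; ring.
Qed.

Lemma L2_tc_tc (n : Z) : n <> 0%Z -> L2 (tc n) (tc n) = PI.
Proof.
intros Hn; rewrite L2_int, tc_tc, cf_int_plus, !cf_int_scal, Z.sub_diag, cf_int_tc_0, cf_int_tc by lia.
field.
Qed.

(** The separate norms depend on whether [n = 0]; their sum does not. *)
Lemma L2_tc_ts_sum (n : Z) : L2 (tc n) (tc n) + L2 (ts n) (ts n) = 2 * PI.
Proof.
rewrite !L2_int, tc_tc, ts_ts, !cf_int_plus, !cf_int_scal, Z.sub_diag, cf_int_tc_0; field.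
Qed.

(** * Completeness of the trigonometric system *)

Lemma cf_int_shift (u : circle_fun) (a : R) : RInt u a (a + 2 * PI) = cf_int u.
Proof.
assert (E : RInt u (2 * PI) (a + 2 * PI) = RInt u 0 a).
{ pose proof (RInt_comp_lin (V := R_CompleteNormedModule) u 1 (2 * PI) 0 a (cf_ex_RInt _ _ _)) as H.
  rewrite Rmult_0_r, Rplus_0_l, Rmult_1_l in H; rewrite <- H.
  apply RInt_ext; intros y _.
  rewrite cfun_periodic; unfold scal; simpl; unfold mult; simpl; now rewrite !Rmult_1_l. }
rewrite <- (RInt_Chasles u a 0), <- (RInt_Chasles u 0 (2 * PI)), E by apply cf_ex_RInt.
rewrite <- (opp_RInt_swap u 0 a) by apply cf_ex_RInt.
unfold plus, opp, cf_int; simpl; ring.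
Qed.

Lemma cos_ge_of_Rabs_le (y d : R) : Rabs y <= d -> d <= PI -> cos d <= cos y.
Proof.
intros Hy Hd; replace (cos y) with (cos (Rabs y)).
- apply cos_decr_1; pose proof (Rabs_pos y); lra.
- unfold Rabs; destruct Rcase_abs; [apply cos_neg|reflexivity].
Qed.

Lemma cos_le_of_Rabs_ge (y d : R) : 0 <= d -> d <= Rabs y -> Rabs y <= PI -> cos y <= cos d.
Proof.
intros Hd Hy Hp; replace (cos y) with (cos (Rabs y)).
- apply cos_decr_1; pose proof (Rabs_pos y); lra.
- unfold Rabs; destruct Rcase_abs; [apply cos_neg|reflexivity].
Qed.

Section FourierUniqueness.
Variables (f : circle_fun).
Hypotheses (Hc : forall n, L2 (tc n) f = 0) (Hs : forall n, L2 (ts n) f = 0).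
Variables (x0 g : R).

Let h : circle_fun :=
  plus (plus (scal (cos x0) (tc 1)) (scal (sin x0) (ts 1))) (scal g (tc 0)).

Let hE (x : R) : h x = cos (x - x0) + g.
Proof.
unfold h; cf_expand; rewrite tc_0E; simpl; rewrite !Rmult_1_l, cos_minus; ring.
Qed.

(** Multiplication by the trigonometric polynomial [h] preserves the span of the modes, and [f] is
    orthogonal to that span. *)
Lemma kernel_moments (n : nat) :
  (forall j, L2 (Nat.iter n (cf_mult h) (tc j)) f = 0) /\
  (forall j, L2 (Nat.iter n (cf_mult h) (ts j)) f = 0).
Proof.
assert (Hp : forall n u v, Nat.iter n (cf_mult h) (plus u v) =
  plus (Nat.iter n (cf_mult h) u) (Nat.iter n (cf_mult h) v)).
{ clear; induction n as [|n IH]; intros u v; [reflexivity|]; simpl; rewrite IH; cf_ring. }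
assert (Hl : forall n c u, Nat.iter n (cf_mult h) (scal c u) =
  scal c (Nat.iter n (cf_mult h) u)).
{ clear; induction n as [|n IH]; intros c u; [reflexivity|]; simpl; rewrite IH; cf_ring. }
assert (E : forall e, cf_mult h e = plus (plus (scal (cos x0) (cf_mult (tc 1) e))
  (scal (sin x0) (cf_mult (ts 1) e))) (scal g (cf_mult (tc 0) e))).
{ intros e; unfold h; cf_ring. }
induction n as [|n [IHc IHs]]; [split; assumption|].
split; intros j; rewrite Nat.iter_succ_r, E, ?tc_tc, ?ts_tc, ?tc_ts, ?ts_ts;
  rewrite !Hp, !Hl, !Hp, !Hl, !L2_plus_l, !L2_scal_l, !L2_plus_l, !L2_scal_l, ?IHc, ?IHs; ring.
Qed.

Lemma kernel_int (n : nat) :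
  RInt (fun x => (cos (x - x0) + g) ^ n * f x) (x0 - PI) (x0 + PI) = 0.
Proof.
rewrite <- (proj1 (kernel_moments n) 0%Z), L2_int, <- (cf_int_shift _ (x0 - PI)).
replace (x0 - PI + 2 * PI) with (x0 + PI) by ring.
apply RInt_ext; intros x _; rewrite cf_multE; f_equal.
induction n as [|n IH]; [now rewrite tc_0E|].
change ((cos (x - x0) + g) ^ S n = h x * Nat.iter n (cf_mult h) (tc 0) x).
now rewrite <- IH, hE.
Qed.

End FourierUniqueness.

(* Pairing [f] with powers of a trigonometric polynomial which exceeds [1] near [x0]
   and is bounded by [1] away from [x0]. *)
Lemma fourier_nonpos (f : circle_fun) (x0 : R) :
  (forall n, L2 (tc n) f = 0) -> (forall n, L2 (ts n) f = 0) -> f x0 <= 0.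
Proof.
intros Hc Hs; destruct (Rle_lt_dec (f x0) 0) as [H|H]; [exact H|exfalso].
pose proof PI_RGT_0 as HPI; pose proof PI2_1 as HPI1.
assert (Hc2 : 0 < f x0 / 2) by lra.
destruct (cf_continuous f x0 _ (locally_ball (f x0) (mkposreal _ Hc2))) as [[d Hd] Hf].
set (D := Rmin (d / 2) 1).
assert (HD0 : 0 < D) by (apply Rmin_glb_lt; lra).
assert (HDd : D <= d / 2) by apply Rmin_l.
assert (HD1 : D <= 1) by apply Rmin_r.
assert (Hf' : forall x, Rabs (x - x0) <= D -> f x0 / 2 <= f x).
{ intros x Hx; assert (Hb : Rabs (x - x0) < d) by lra.
  specialize (Hf x Hb); change (Rabs (f x - f x0) < f x0 / 2) in Hf.
  revert Hf; unfold Rabs; destruct Rcase_abs; lra. }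
destruct (cf_bounded f) as [M [HM HfM]].
(* With this [g] the kernel [cos (x - x0) + g] equals [1] at distance [D] from [x0]; [eta] is its
   excess over [1] at distance [D / 2], where Bernoulli's inequality bounds the power [n] below by
   [1 + n * eta]. *)
set (g := 1 - cos D).
set (eta := cos (D / 2) - cos D).
assert (Heta : 0 < eta).
{ unfold eta; pose proof (cos_decreasing_1 (D / 2) D); lra. }
set (q := fun (n : nat) x => (cos (x - x0) + g) ^ n * f x).
assert (Hlow : forall n x, Rabs (x - x0) <= PI -> - M <= q n x).
{ intros n x Hx; unfold q.
  destruct (Rle_lt_dec (Rabs (x - x0)) D) as [Hx1|Hx1].
  - apply Rle_trans with 0; [lra|]; apply Rmult_le_pos.
    + apply pow_le; pose proof (cos_ge_of_Rabs_le _ _ Hx1); unfold g; lra.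
    + specialize (Hf' x Hx1); lra.
  - assert (Hh : Rabs (cos (x - x0) + g) <= 1).
    { pose proof (cos_le_of_Rabs_ge (x - x0) D ltac:(lra) ltac:(lra) Hx).
      pose proof (COS_bound (x - x0)); pose proof (COS_bound D).
      apply Rabs_le; unfold g; lra. }
    apply Rle_trans with (- Rabs ((cos (x - x0) + g) ^ n * f x)).
    + apply Ropp_le_contravar; rewrite Rabs_mult, <- RPow_abs, <- (Rmult_1_l M).
      apply Rmult_le_compat; auto using Rabs_pos.
      * apply pow_le, Rabs_pos.
      * rewrite <- (pow1 n); apply pow_incr; split; [apply Rabs_pos|exact Hh].
    + unfold Rabs; destruct Rcase_abs; lra. }
assert (Hup : forall n x, Rabs (x - x0) <= D / 2 -> f x0 / 2 * (1 + INR n * eta) <= q n x).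
{ intros n x Hx; unfold q; rewrite Rmult_comm.
  specialize (Hf' x ltac:(lra)).
  assert (Hh : 1 + eta <= cos (x - x0) + g).
  { pose proof (cos_ge_of_Rabs_le _ _ Hx ltac:(lra)); unfold eta, g; lra. }
  apply Rmult_le_compat; [pose proof (pos_INR n); nra|lra| |exact Hf'].
  apply Rle_trans with ((1 + eta) ^ n).
  - apply poly; exact Heta.
  - apply pow_incr; lra. }
assert (Hex : forall n a b, ex_RInt (q n) a b).
{ intros n a b; apply (ex_RInt_continuous (V := R_CompleteNormedModule)); intros y _.
  apply (continuous_mult (K := R_AbsRing)); [|apply cf_continuous].
  apply (ex_derive_continuous (V := R_NormedModule)); auto_derive; trivial. }
assert (Hconst : forall a b c n, a <= b -> (forall x, a < x < b -> c <= q n x) ->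
  (b - a) * c <= RInt (q n) a b).
{ intros a b c n Hab Hx; replace ((b - a) * c) with (RInt (fun _ => c) a b).
  - apply RInt_le; auto; apply ex_RInt_const.
  - rewrite RInt_const; reflexivity. }
(* The central interval, of length [D], contributes an amount growing linearly in [n]; the rest of
   the period costs at most [2 * PI * M]. *)
assert (Hn : forall n, D * (f x0 / 2 * (1 + INR n * eta)) - 2 * PI * M <= 0).
{ intros n.
  pose proof (kernel_int f Hc Hs x0 g n) as E; fold (q n) in E.
  change (RInt (q n) (x0 - PI) (x0 + PI) = 0) in E.
  rewrite <- (RInt_Chasles (q n) (x0 - PI) (x0 - D / 2)),
          <- (RInt_Chasles (q n) (x0 - D / 2) (x0 + D / 2)) in E by apply Hex.
  unfold plus in E; simpl in E.
  pose proof (Hconst (x0 - PI) (x0 - D / 2) (- M) n ltac:(lra)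
    ltac:(intros; apply Hlow, Rabs_le; lra)).
  pose proof (Hconst (x0 + D / 2) (x0 + PI) (- M) n ltac:(lra)
    ltac:(intros; apply Hlow, Rabs_le; lra)).
  pose proof (Hconst (x0 - D / 2) (x0 + D / 2) _ n ltac:(lra)
    ltac:(intros; apply Hup, Rabs_le; lra)).
  nra. }
assert (Hpos : 0 < D * (f x0 / 2) * eta) by (repeat apply Rmult_lt_0_compat; lra).
destruct (INR_unbounded (2 * PI * M / (D * (f x0 / 2) * eta))) as [n Hbig].
specialize (Hn n).
apply Rgt_lt, (Rmult_lt_compat_r _ _ _ Hpos) in Hbig.
replace (2 * PI * M / (D * (f x0 / 2) * eta) * (D * (f x0 / 2) * eta))
  with (2 * PI * M) in Hbig by (field; lra).
assert (0 < D * (f x0 / 2)) by nra; nra.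
Qed.

Lemma fourier_unique (f : circle_fun) :
  (forall n, L2 (tc n) f = 0) -> (forall n, L2 (ts n) f = 0) -> f = zero.
Proof.
intros Hc Hs; apply circle_fun_ext; intros x; rewrite cf_zeroE.
apply Rle_antisym; [now apply fourier_nonpos|].
assert (H : scal (-1) f x <= 0).
{ apply fourier_nonpos; intros n; rewrite L2_scal_r, ?Hc, ?Hs; ring. }
rewrite cf_scalE in H; lra.
Qed.

(** * Rigidity *)

Lemma quadratic_primitive (f : R -> R) (a b c x : R) :
  (forall s, is_derive f s (a + b * s + c * s ^ 2)) ->
  f x - f 0 = a * x + b * x ^ 2 / 2 + c * x ^ 3 / 3.
Proof.
intros H; set (g := fun s => f s - (a * s + b * s ^ 2 / 2 + c * s ^ 3 / 3)).
assert (Hg : forall s, is_derive g s zero).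
{ intros s; unfold g; evar_last.
  - apply (is_derive_minus (K := R_AbsRing) (V := R_NormedModule)); [apply H|].
    auto_derive; [trivial|reflexivity].
  - unfold minus, plus, opp, zero; simpl; field. }
assert (E : g x = g 0).
{ destruct (Rtotal_order x 0) as [Hx|[Hx|Hx]].
  - apply (eq_is_derive (V := R_NormedModule) g x 0); auto.
  - now subst.
  - symmetry; apply (eq_is_derive (V := R_NormedModule) g 0 x); auto. }
unfold g in E; simpl in E; lra.
Qed.

(** Going from the origin to a corner along the two sides of a square in either order gives the same
    increment of [psi]. Adding these identities for the corners [(1, 1)] and [(-1, -1)] cancels the
    cubic terms and leaves [p2 = q1]. *)
Lemma quadratic_mixed_partials (psi : R -> R -> R) (p0 p1 p2 p3 p4 p5 q0 q1 q2 q3 q4 q5 : R) :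
  (forall s t, is_derive (fun s => psi s t) s
     (p0 + p1 * s + p2 * t + p3 * s ^ 2 + p4 * s * t + p5 * t ^ 2)) ->
  (forall s t, is_derive (fun t => psi s t) t
     (q0 + q1 * s + q2 * t + q3 * s ^ 2 + q4 * s * t + q5 * t ^ 2)) ->
  p2 = q1.
Proof.
intros Hs Ht.
assert (Ps : forall s t, psi s t - psi 0 t =
  (p0 + p2 * t + p5 * t ^ 2) * s + (p1 + p4 * t) * s ^ 2 / 2 + p3 * s ^ 3 / 3).
{ intros s t; apply (quadratic_primitive (fun s => psi s t)); intros r.
  evar_last; [apply Hs|ring]. }
assert (Pt : forall s t, psi s t - psi s 0 =
  (q0 + q1 * s + q3 * s ^ 2) * t + (q2 + q4 * s) * t ^ 2 / 2 + q5 * t ^ 3 / 3).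
{ intros s t; apply (quadratic_primitive (fun t => psi s t)); intros r.
  evar_last; [apply Ht|ring]. }
pose proof (Ps 1 1); pose proof (Ps 1 0); pose proof (Pt 1 1); pose proof (Pt 0 1).
pose proof (Ps (-1) (-1)); pose proof (Ps (-1) 0); pose proof (Pt (-1) (-1)); pose proof (Pt 0 (-1)).
lra.
Qed.

Lemma dir_derive_is_derive (F : circle_fun -> R) (h : circle_fun) (l : circle_fun -> R) :
  (forall m, is_dir_derive (V := cf_NormedModuleAux) (W := R_NormedModuleAux) F m h (l m)) ->
  forall m s, is_derive (fun s => F (plus m (scal s h))) s (l (plus m (scal s h))).
Proof.
intros H m s; apply is_derive_Reals; intros eps Heps.
destruct (H (plus m (scal s h)) _ (locally_ball (l (plus m (scal s h))) (mkposreal _ Heps)))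
  as [d Hd].
exists d; intros t Ht Htd.
assert (Hb : ball 0 d t) by (change (Rabs (t + - 0) < d); rewrite Ropp_0, Rplus_0_r; exact Htd).
specialize (Hd t Hb Ht).
change (Rabs (/ t * (F (plus (plus m (scal s h)) (scal t h)) - F (plus m (scal s h)))
  - l (plus m (scal s h))) < eps) in Hd.
assert (E : F (plus (plus m (scal s h)) (scal t h)) = F (plus m (scal (s + t) h)))
  by (f_equal; cf_ring).
unfold Rdiv; rewrite Rmult_comm.
exact (eq_ind _ (fun y => Rabs (/ t * (y - F (plus m (scal s h))) - l (plus m (scal s h))) < eps)
  Hd _ E).
Qed.

(* The second derivative of [F] in the directions [Q v] and [Q w] is symmetric; as
   [Q o dF] is the Euler field, it only involves the derivative of the latter. *)
Lemma hamiltonian_symmetry (A Ainv Q : circle_fun -> circle_fun) (F : circle_fun -> R)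
    (dF : circle_fun -> circle_fun) (m v w : circle_fun) :
  L2_symmetric A -> continuous_linear_iso A Ainv -> L2_skew Q ->
  (forall m M, is_dir_derive (V := cf_NormedModuleAux) (W := R_NormedModuleAux) F m M (L2 M (dF m))) ->
  (forall m, euler_field Ainv m = Q (dF m)) ->
  L2 (minus (bracket v (Ainv m)) (Ainv (lie_poisson m v))) (Q w) =
  L2 (minus (bracket w (Ainv m)) (Ainv (lie_poisson m w))) (Q v).
Proof.
intros HA [_ [[Ip [Is _]] [_ HAI]]] HQ HF HX.
(* The bilinear map behind the quadratic Euler field, paired with [v]. *)
set (B := fun v M N => L2 v (lie_poisson M (Ainv N))).
assert (HB : forall u V W s t,
  L2 (Q u) (dF (plus (plus m (scal s V)) (scal t W))) =
  - (B u m m) + - (B u m V + B u V m) * s + - (B u m W + B u W m) * t +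
  - (B u V V) * s ^ 2 + - (B u V W + B u W V) * s * t + - (B u W W) * t ^ 2).
{ intros u V W s t; rewrite HQ, <- HX; unfold euler_field, B.
  rewrite !Ip, !Is.
  replace (lie_poisson (plus (plus m (scal s V)) (scal t W))
      (plus (plus (Ainv m) (scal s (Ainv V))) (scal t (Ainv W))))
    with (plus (plus (plus (lie_poisson m (Ainv m))
        (scal s (plus (lie_poisson m (Ainv V)) (lie_poisson V (Ainv m)))))
        (scal t (plus (lie_poisson m (Ainv W)) (lie_poisson W (Ainv m)))))
      (plus (plus (scal (s ^ 2) (lie_poisson V (Ainv V)))
        (scal (s * t) (plus (lie_poisson V (Ainv W)) (lie_poisson W (Ainv V)))))
        (scal (t ^ 2) (lie_poisson W (Ainv W))))) by cf_ring.
  repeat rewrite ?L2_plus_r, ?L2_scal_r; ring. }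
(* The transpose of the derivative of the Euler field at [m], applied to [u]. *)
assert (Hl : forall u M, L2 (minus (bracket u (Ainv m)) (Ainv (lie_poisson m u))) M =
  B u m M + B u M m).
{ intros u M; unfold B; rewrite (L2_lie_poisson_bracket u M), (L2_lie_poisson_skew u m).
  rewrite (symmetric_inverse A Ainv M) by assumption.
  rewrite L2_minus_l, (L2_comm _ M), (L2_comm _ M); ring. }
rewrite !Hl; apply Ropp_eq_reg.
refine (quadratic_mixed_partials
  (fun s t => F (plus (plus m (scal s (Q v))) (scal t (Q w)))) _ _ _ _ _ _ _ _ _ _ _ _ _ _).
- intros s t; rewrite <- HB.
  assert (E : forall s, plus (plus m (scal s (Q v))) (scal t (Q w)) =
                        plus (plus m (scal t (Q w))) (scal s (Q v))) by (intros; cf_ring).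
  rewrite E; apply (is_derive_ext (fun s => F (plus (plus m (scal t (Q w))) (scal s (Q v))))).
  + intros r; now rewrite E.
  + exact (dir_derive_is_derive F (Q v) (fun m => L2 (Q v) (dF m)) (fun m => HF m (Q v)) _ s).
- intros s t; rewrite <- HB.
  exact (dir_derive_is_derive F (Q w) (fun m => L2 (Q w) (dF m)) (fun m => HF m (Q w)) _ t).
Qed.

(* [(Re i^k, Im i^k)] *)
Fixpoint ipow (k : nat) : R * R :=
  match k with O => (1, 0) | S k => (- snd (ipow k), fst (ipow k)) end.

Lemma ipow_unit (k : nat) : fst (ipow k) ^ 2 + snd (ipow k) ^ 2 = 1.
Proof. induction k as [|k IH]; simpl in *; lra. Qed.

Lemma iter_D_trig (k : nat) (n : Z) :
  Nat.iter k cf_D (tc n) = plus (scal (fst (ipow k) * IZR n ^ k) (tc n))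
                                (scal (- (snd (ipow k) * IZR n ^ k)) (ts n)) /\
  Nat.iter k cf_D (ts n) = plus (scal (fst (ipow k) * IZR n ^ k) (ts n))
                                (scal (snd (ipow k) * IZR n ^ k) (tc n)).
Proof.
induction k as [|k [IHc IHs]].
- split; simpl; cf_ring.
- change (Nat.iter (S k) cf_D (tc n)) with (cf_D (Nat.iter k cf_D (tc n))).
  change (Nat.iter (S k) cf_D (ts n)) with (cf_D (Nat.iter k cf_D (ts n))).
  rewrite IHc, IHs, !cf_D_plus, !cf_D_scal, D_tc, D_ts; split;
    apply circle_fun_ext; intros x; cf_expand; simpl; ring.
Qed.

Lemma const_coeff_trig (c : nat -> R) (N : nat) (n : Z) :
  let al := pol N (fun k => c k * fst (ipow k)) (IZR n) in
  let be := pol N (fun k => c k * snd (ipow k)) (IZR n) in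
  sum_n (fun k => scal (c k) (Nat.iter k cf_D (tc n))) N
    = plus (scal al (tc n)) (scal (- be) (ts n)) /\
  sum_n (fun k => scal (c k) (Nat.iter k cf_D (ts n))) N
    = plus (scal al (ts n)) (scal be (tc n)).
Proof.
unfold pol; induction N as [|N [IHc IHs]]; simpl.
- rewrite !sum_O; split; apply circle_fun_ext; intros x; cf_expand; simpl; ring.
- simpl in IHc, IHs; destruct (iter_D_trig (S N) n) as [Ec Es]; rewrite !sum_Sn, IHc, IHs.
  rewrite Ec, Es.
  split; apply circle_fun_ext; intros x; cf_expand; unfold plus; simpl; ring.
Qed.

(** The two vacant degrees above [N] leave room for multiplying the symbol by [n ^ 2] when
    coefficients are compared. *)
Lemma const_coeff_extend (A : circle_fun -> circle_fun) :
  const_coeff_diff_operator A ->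
  exists N c, (forall k, (N < k)%nat -> c k = 0) /\
    forall u, A u = sum_n (fun k => scal (c k) (Nat.iter k cf_D u)) (2 + N).
Proof.
intros [N [c Hc]]; exists N, (fun k => if le_dec k N then c k else 0); split.
- intros k Hk; destruct le_dec; [lia|reflexivity].
- intros u; rewrite Hc, (sum_n_support _ N (2 + N)).
  + apply sum_n_ext_loc; intros k Hk; destruct le_dec; [reflexivity|lia].
  + intros k Hk; destruct le_dec; [lia|]; apply circle_fun_ext; intros x; cf_expand; ring.
  + lia.
Qed.

Lemma Z_finite_bound (f : Z -> R) (N : nat) :
  exists C, forall j, (0 <= j < Z.of_nat N)%Z -> Rabs (f j) <= C.
Proof.
induction N as [|N [C HC]]; [exists 0; lia|].
exists (Rmax C (Rabs (f (Z.of_nat N)))); intros j Hj.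
destruct (Z.eq_dec j (Z.of_nat N)) as [->|E]; [apply Rmax_r|].
apply Rle_trans with (2 := Rmax_l _ _); apply HC; lia.
Qed.

Lemma pol_sub_dilates (N : nat) (d : nat -> R) (x : R) :
  pol N (fun i => d i * (3 ^ i - 4 * 2 ^ i + 5)) x =
  pol N d (3 * x) - 4 * pol N d (2 * x) + 5 * pol N d x.
Proof.
unfold pol; induction N as [|N IH]; [rewrite !sum_O; simpl; ring|].
rewrite !sum_Sn, IH, !Rpow_mult_distr; unfold plus; simpl; ring.
Qed.

(** The exponents [1] and [3] are the zeros of this expression, which is why only [D] and [D ^ 3]
    survive. From [4] on, [3 ^ i] exceeds [4 * 2 ^ i], starting with [81 > 64]. *)
Lemma pow_cocycle_neq (i : nat) : i <> 1%nat -> i <> 3%nat -> 3 ^ i - 4 * 2 ^ i + 5 <> 0.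
Proof.
intros H1 H3; destruct i as [|[|[|[|i]]]]; try lia; [simpl; lra|simpl; lra|].
assert (P : forall i, 0 < 2 ^ i /\ 4 * 2 ^ (4 + i) < 3 ^ (4 + i)).
{ clear; induction i as [|i [IH0 IH]]; [simpl; lra|simpl in *; lra]. }
destruct (P i) as [_ H]; simpl in *; lra.
Qed.

(** * The matrix of [Q] in the trigonometric modes *)

Section Spectral.
Variables (Ainv Q : circle_fun -> circle_fun) (al : Z -> R).
Hypothesis al_neq_0 : forall n, al n <> 0.
Hypothesis Ainv_minus : forall u v, Ainv (minus u v) = minus (Ainv u) (Ainv v).
Hypothesis Ainv_scal : forall c u, Ainv (scal c u) = scal c (Ainv u).
Hypothesis Ainv_tc : forall n, Ainv (tc n) = scal (/ al n) (tc n).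
Hypothesis Ainv_ts : forall n, Ainv (ts n) = scal (/ al n) (ts n).
Hypothesis al_superlinear :
  forall M, exists X, forall n, X <= IZR n -> M * IZR n <= Rabs (al n).
Hypothesis Q_cocycle : local_cocycle Q.
Hypothesis Q_symmetry : forall m v w,
  L2 (minus (bracket v (Ainv m)) (Ainv (lie_poisson m v))) (Q w) =
  L2 (minus (bracket w (Ainv m)) (Ainv (lie_poisson m w))) (Q v).

Let Q_skew (u v : circle_fun) : L2 u (Q v) = - L2 v (Q u).
Proof. rewrite (L2_comm u); apply (proj1 (proj2 Q_cocycle)). Qed.

(* Eigenvalue on [tc n], [ts n] of the linearization of the Euler field at [m = 1]. *)
Definition ell (n : Z) : R := IZR n * (/ al 0 + 2 / al n).

Lemma symmetry_at_1 (n : Z) :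
  minus (bracket (tc n) (Ainv (tc 0))) (Ainv (lie_poisson (tc 0) (tc n))) = scal (ell n) (ts n) /\
  minus (bracket (ts n) (Ainv (tc 0))) (Ainv (lie_poisson (tc 0) (ts n))) = scal (- ell n) (tc n).
Proof.
replace (lie_poisson (tc 0) (tc n)) with (scal (- 2 * IZR n) (ts n)).
2:{ unfold lie_poisson; rewrite !D_tc; apply circle_fun_ext; intros x; cf_expand; rewrite tc_0E; ring. }
replace (lie_poisson (tc 0) (ts n)) with (scal (2 * IZR n) (tc n)).
2:{ unfold lie_poisson; rewrite D_tc, D_ts; apply circle_fun_ext; intros x; cf_expand; rewrite tc_0E; ring. }
rewrite !Ainv_scal, !Ainv_tc, Ainv_ts; unfold bracket.
rewrite !cf_D_scal, !D_tc, D_ts.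
split; apply circle_fun_ext; intros x; cf_expand; rewrite tc_0E; unfold ell; field; auto.
Qed.

(** Skewness pairs the entries of [Q] between the modes [j] and [n] into two homogeneous linear
    systems of size 2, one for [S] and [S'], one for [C] and [T], each with determinant
    [ell j ^ 2 - ell n ^ 2] up to sign. *)
Lemma decoupled (j n : Z) :
  ell j ^ 2 <> ell n ^ 2 -> L2 (ts j) (Q (tc n)) = 0 /\ L2 (tc j) (Q (tc n)) = 0.
Proof.
intros H.
assert (Hcc : forall j n, ell j * L2 (ts j) (Q (tc n)) = ell n * L2 (ts n) (Q (tc j))).
{ intros j' n'; pose proof (Q_symmetry (tc 0) (tc j') (tc n')) as E.
  rewrite !(proj1 (symmetry_at_1 _)), !L2_scal_l in E; exact E. }
assert (Hcs : forall j n, ell j * L2 (ts j) (Q (ts n)) = - ell n * L2 (tc n) (Q (tc j))).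
{ intros j' n'; pose proof (Q_symmetry (tc 0) (tc j') (ts n')) as E.
  rewrite (proj1 (symmetry_at_1 _)), (proj2 (symmetry_at_1 _)), !L2_scal_l in E; exact E. }
assert (Hss : ell j * L2 (tc j) (Q (ts n)) = ell n * L2 (tc n) (Q (ts j))).
{ pose proof (Q_symmetry (tc 0) (ts j) (ts n)) as E.
  rewrite !(proj2 (symmetry_at_1 _)), !L2_scal_l in E; lra. }
pose proof (Hcc j n) as E1; pose proof (Hcs j n) as E2; pose proof (Hcs n j) as E3.
rewrite (Q_skew (tc j) (ts n)), (Q_skew (tc n) (ts j)) in Hss.
rewrite (Q_skew (ts n) (ts j)) in E3; rewrite (Q_skew (tc n) (tc j)) in E2.
set (S := L2 (ts j) (Q (tc n))) in *; set (S' := L2 (ts n) (Q (tc j))) in *.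
set (C := L2 (tc j) (Q (tc n))) in *; set (T := L2 (ts j) (Q (ts n))) in *.
split; apply (Rmult_eq_reg_l (ell j ^ 2 - ell n ^ 2)); try lra.
- replace ((ell j ^ 2 - ell n ^ 2) * S) with (ell j * (ell j * S) - ell n * (ell n * S)) by ring.
  rewrite E1; replace (ell n * S) with (ell j * S') by lra; ring.
- replace ((ell j ^ 2 - ell n ^ 2) * C) with (ell j * (ell j * C) - ell n * (ell n * C)) by ring.
  replace (ell n * C) with (ell j * T) by lra; replace (ell j * C) with (ell n * T) by lra; ring.
Qed.

(** Beyond some [n0], [al 0 * ell n] is within [/ 10] of [n], so such values have distinct squares;
    the finitely many values below [n0] are bounded and are left behind by a larger [n1]. *)
Lemma ell_separated :
  exists n1, (0 < n1)%Z /\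
    forall n j, (n1 <= n)%Z -> (0 <= j)%Z -> j <> n -> ell j ^ 2 <> ell n ^ 2.
Proof.
set (lam := fun n => al 0 * ell n).
(* The factor [20] keeps [2 n al 0 / al n], the deviation of [lam n] from [n], within [/ 10]. *)
destruct (al_superlinear (20 * Rabs (al 0))) as [X HX].
destruct (Z_above 1 X) as [n0 [Hn0 HnX]].
assert (H0 : 0 < Rabs (al 0)) by apply Rabs_pos_lt, al_neq_0.
assert (Hlam : forall n, (n0 <= n)%Z -> IZR n - / 10 <= lam n <= IZR n + / 10).
{ intros n Hn; specialize (HX n (Rle_trans _ _ _ HnX (IZR_le _ _ Hn))).
  assert (Hn1 : 1 <= IZR n) by (apply IZR_le; lia).
  replace (lam n) with (IZR n + 2 * IZR n * al 0 / al n).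
  2:{ unfold lam, ell; field; auto. }
  assert (Hb : Rabs (2 * IZR n * al 0 / al n) <= / 10).
  { pose proof (Rabs_pos_lt _ (al_neq_0 n)) as Hn2.
    unfold Rdiv; rewrite !Rabs_mult, Rabs_inv, (Rabs_pos_eq 2), (Rabs_pos_eq (IZR n)) by lra.
    apply (Rmult_le_reg_r (Rabs (al n))); [exact Hn2|].
    replace (2 * IZR n * Rabs (al 0) * / Rabs (al n) * Rabs (al n))
      with (2 * IZR n * Rabs (al 0)) by (field; lra); lra. }
  apply Rabs_le_between in Hb; lra. }
destruct (Z_finite_bound lam (Z.to_nat n0)) as [C HC].
rewrite Z2Nat.id in HC by lia.
destruct (Z_above n0 (C + 1)) as [n1 [Hn1 HnC]].
exists n1; split; [lia|]; intros n j Hn Hj Hjn E.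
assert (E' : lam j ^ 2 = lam n ^ 2).
{ unfold lam; replace ((al 0 * ell j) ^ 2) with (al 0 ^ 2 * ell j ^ 2) by ring; rewrite E; ring. }
pose proof (Hlam n ltac:(lia)) as Ln.
pose proof (IZR_le _ _ Hn) as In; pose proof (IZR_le 1 n ltac:(lia)) as In1.
destruct (Z_lt_dec j n0) as [Hj0|Hj0].
- specialize (HC j ltac:(lia)); apply Rabs_le_between in HC.
  assert (lam j < lam n /\ - lam n < lam j) by lra; nra.
- pose proof (Hlam j ltac:(lia)) as Lj.
  pose proof (IZR_le 1 j ltac:(lia)) as Ij1.
  assert (D : IZR j + 1 <= IZR n \/ IZR n + 1 <= IZR j).
  { rewrite <- !plus_IZR; destruct (Z_lt_dec j n); [left|right]; apply IZR_le; lia. }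
  destruct D; nra.
Qed.

Definition sig (n : Z) : R := L2 (ts n) (Q (tc n)).

(** A single entry also sees the Fourier coefficients of [a k] at [2 n]. Averaging with its skew
    partner leaves [sin ^ 2 + cos ^ 2], hence only the means of the [a k], and the formula is
    polynomial at low modes as well. The spare degrees make the index [3] available. *)
Lemma sig_pol : exists N d,
  (forall k, (N < k)%nat -> d k = 0) /\ forall n, sig n = pol (3 + N) d (IZR n).
Proof.
destruct (proj1 Q_cocycle) as [N [a Ha]].
exists N, (fun k => if le_dec k N then - (snd (ipow k) * cf_int (a k)) / 2 else 0).
split.
- intros k Hk; destruct le_dec; [lia|reflexivity].
- intros n; unfold pol; rewrite (sum_n_support _ N (3 + N)); [|
    intros k Hk; destruct le_dec; [lia|apply Rmult_0_l]|lia].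
  assert (E : 2 * sig n = L2 (ts n) (Q (tc n)) - L2 (tc n) (Q (ts n))).
  { rewrite (Q_skew (tc n)); unfold sig; ring. }
  apply (Rmult_eq_reg_l 2); [|lra]; rewrite E, !Ha, !L2_sum_n_r; clear.
  set (d := fun k => if le_dec k N then - (snd (ipow k) * cf_int (a k)) / 2 else 0).
  assert (G : forall M, (M <= N)%nat ->
    sum_n (fun k => L2 (ts n) (cf_mult (a k) (Nat.iter k cf_D (tc n)))) M -
    sum_n (fun k => L2 (tc n) (cf_mult (a k) (Nat.iter k cf_D (ts n)))) M =
    2 * sum_n (fun k => d k * IZR n ^ k) M); [|apply G; lia].
  assert (T : forall k, (k <= N)%nat ->
    L2 (ts n) (cf_mult (a k) (Nat.iter k cf_D (tc n))) -
    L2 (tc n) (cf_mult (a k) (Nat.iter k cf_D (ts n))) = 2 * (d k * IZR n ^ k)).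
  { intros k Hk; unfold d; destruct le_dec; [|lia].
    destruct (iter_D_trig k n) as [-> ->]; rewrite !L2_int.
    replace (2 * (- (snd (ipow k) * cf_int (a k)) / 2 * IZR n ^ k))
      with (- (snd (ipow k) * IZR n ^ k) * cf_int (a k)) by field.
    set (re := fst (ipow k) * IZR n ^ k); set (im := snd (ipow k) * IZR n ^ k).
    rewrite <- cf_int_scal.
    enough (E : cf_int (cf_mult (ts n) (cf_mult (a k) (plus (scal re (tc n)) (scal (- im) (ts n))))) =
      cf_int (scal (- im) (a k)) +
      cf_int (cf_mult (tc n) (cf_mult (a k) (plus (scal re (ts n)) (scal im (tc n)))))) by lra.
    rewrite <- cf_int_plus; f_equal; apply circle_fun_ext; intros x; cf_expand; simpl.
    pose proof (sin2_cos2 (IZR n * x)) as E; unfold Rsqr in E.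
    set (si := sin (IZR n * x)) in *; set (co := cos (IZR n * x)) in *.
    replace (- im * a k x) with (- im * a k x * (si * si + co * co)) by (rewrite E; ring).
    ring. }
  induction M as [|M IH]; intros HM; [rewrite !sum_O; apply T; lia|].
  rewrite !sum_Sn; unfold plus; simpl.
  specialize (IH ltac:(lia)); specialize (T (S M) HM); simpl in T; lra.
Qed.

Lemma sig_cubic (n1 : Z) :
  (forall k, (n1 <= k)%Z -> sig (3 * k) = 4 * sig (2 * k) - 5 * sig k) ->
  exists c1 c3, forall n, sig n = c1 * IZR n + c3 * IZR n ^ 3.
Proof.
intros H; destruct sig_pol as [N [d [Hd Hs]]].
assert (Z : forall i, (i <= 3 + N)%nat -> d i * (3 ^ i - 4 * 2 ^ i + 5) = 0).
{ apply (pol_zero (3 + N) _ n1); intros n Hn.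
  rewrite pol_sub_dilates, <- !mult_IZR, <- !Hs, H by exact Hn; ring. }
assert (Z' : forall i, i <> 1%nat -> i <> 3%nat -> d i = 0).
{ intros i H1 H3; destruct (le_dec i N) as [Hi|Hi]; [|apply Hd; lia].
  destruct (Rmult_integral _ _ (Z i ltac:(lia))) as [E|E]; [exact E|].
  exfalso; exact (pow_cocycle_neq i H1 H3 E). }
exists (d 1%nat), (d 3%nat); intros n; rewrite Hs; unfold pol.
rewrite (sum_n_support _ 3); [|intros k Hk; rewrite Z' by lia; apply Rmult_0_l|lia].
rewrite !sum_Sn, sum_O; unfold plus; simpl.
rewrite (Z' 0%nat), (Z' 2%nat) by lia; ring.
Qed.

Lemma bracket_tc_tc (a b : Z) : bracket (tc a) (tc b) =
  plus (scal ((IZR a - IZR b) / 2) (ts (a + b))) (scal ((IZR a + IZR b) / 2) (ts (a - b))).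
Proof.
unfold bracket; rewrite !D_tc.
transitivity (minus (scal (- IZR b) (cf_mult (tc a) (ts b))) (scal (- IZR a) (cf_mult (ts a) (tc b)))).
- cf_ring.
- rewrite tc_ts, ts_tc; apply circle_fun_ext; intros x; cf_expand; field.
Qed.

Lemma lie_poisson_tc_tc (a b : Z) : lie_poisson (tc a) (tc b) =
  minus (scal (IZR b - IZR a / 2) (ts (a - b))) (scal (IZR b + IZR a / 2) (ts (a + b))).
Proof.
unfold lie_poisson; rewrite !D_tc.
transitivity (plus (scal (- 2 * IZR b) (cf_mult (tc a) (ts b))) (scal (- IZR a) (cf_mult (ts a) (tc b)))).
- cf_ring.
- rewrite tc_ts, ts_tc; apply circle_fun_ext; intros x; cf_expand; field.
Qed.

Section LargeModes.
Variable n1 : Z.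
Hypothesis n1_pos : (0 < n1)%Z.
Hypothesis separated :
  forall n j, (n1 <= n)%Z -> (0 <= j)%Z -> j <> n -> ell j ^ 2 <> ell n ^ 2.

Lemma off_diagonal (n j : Z) :
  (n1 <= n)%Z -> j <> n -> j <> (- n)%Z ->
  L2 (ts j) (Q (tc n)) = 0 /\ L2 (tc j) (Q (tc n)) = 0.
Proof.
intros Hn Hj Hj'; destruct (Z_le_dec 0 j) as [Hp|Hp].
- apply decoupled, separated; assumption.
- rewrite <- (Z.opp_involutive j), ts_opp, tc_opp, L2_scal_l.
  destruct (decoupled (- j) n) as [-> ->]; [apply separated; lia|split; ring].
Qed.

(** Of the two modes in each bracket one is resonant with the third argument, because
    [k + 2 k = 3 k]; the other is off-diagonal. *)
Lemma sig_cocycle (k : Z) : (n1 <= k)%Z -> sig (3 * k) = 4 * sig (2 * k) - 5 * sig k.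
Proof.
intros Hk; pose proof (proj2 (proj2 Q_cocycle) (tc k) (tc (2 * k)) (tc (3 * k))) as E.
cbv beta in E; rewrite !bracket_tc_tc, !L2_plus_l, !L2_scal_l in E.
rewrite (proj1 (off_diagonal (3 * k) (k - 2 * k) ltac:(lia) ltac:(lia) ltac:(lia))) in E.
rewrite (proj1 (off_diagonal k (2 * k + 3 * k) ltac:(lia) ltac:(lia) ltac:(lia))) in E.
rewrite (proj1 (off_diagonal (2 * k) (3 * k + k) ltac:(lia) ltac:(lia) ltac:(lia))) in E.
replace (k + 2 * k)%Z with (3 * k)%Z in E by ring.
replace (2 * k - 3 * k)%Z with (- k)%Z in E by ring.
replace (3 * k - k)%Z with (2 * k)%Z in E by ring.
rewrite ts_opp, L2_scal_l in E; fold (sig k) (sig (2 * k)) (sig (3 * k)) in E.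
rewrite !mult_IZR in E.
assert (Hk0 : 1 <= IZR k) by (apply IZR_le; lia).
apply (Rmult_eq_reg_l (IZR k)); lra.
Qed.

Lemma sig_hamiltonian (k : Z) :
  (n1 <= k)%Z -> 2 * sig k * al (2 * k) = sig (2 * k) * al k.
Proof.
intros Hk; pose proof (Q_symmetry (tc k) (tc (2 * k)) (tc k)) as E.
rewrite Ainv_tc in E.
assert (Hb : forall c u v, bracket u (scal c v) = scal c (bracket u v)) by (intros; cf_ring).
rewrite !Hb, !bracket_tc_tc, !lie_poisson_tc_tc, !Ainv_minus, !Ainv_scal, !Ainv_ts in E.
repeat rewrite ?L2_minus_l, ?L2_plus_l, ?L2_scal_l in E.
rewrite (proj1 (off_diagonal k (2 * k + k) ltac:(lia) ltac:(lia) ltac:(lia))) in E.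
rewrite (proj1 (off_diagonal k (k + 2 * k) ltac:(lia) ltac:(lia) ltac:(lia))) in E.
rewrite (proj1 (off_diagonal (2 * k) (k - k) ltac:(lia) ltac:(lia) ltac:(lia))) in E.
replace (k - 2 * k)%Z with (- k)%Z in E by ring.
replace (2 * k - k)%Z with k in E by ring.
replace (k + k)%Z with (2 * k)%Z in E by ring.
(* The symbol is even because [tc (- k)] and [tc k] are the same function, nonzero at [0]. *)
assert (Eal : al (- k) = al k).
{ pose proof (Ainv_tc (- k)) as H; rewrite tc_opp, Ainv_tc in H.
  pose proof (f_equal (fun u : circle_fun => u 0) H) as H0; simpl in H0.
  rewrite Rmult_0_r, cos_0, !Rmult_1_r in H0; apply Rinv_eq_reg; auto. }
rewrite Eal, ts_opp, !L2_scal_l in E; fold (sig k) (sig (2 * k)) in E.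
rewrite !mult_IZR in E.
assert (Hk0 : 1 <= IZR k) by (apply IZR_le; lia).
assert (E' : 3 * IZR k * / al k * sig k = 3 / 2 * IZR k * / al (2 * k) * sig (2 * k)) by lra.
assert (E2 : 2 * (/ al k * sig k) = / al (2 * k) * sig (2 * k)).
{ apply (Rmult_eq_reg_l (IZR k)); lra. }
pose proof (al_neq_0 k); pose proof (al_neq_0 (2 * k)).
transitivity (2 * (/ al k * sig k) * (al k * al (2 * k))); [field; assumption|].
rewrite E2; field; assumption.
Qed.

(** The cosine diagonal entry vanishes by skewness, the sine one is [sig n], and all others are
    off-diagonal; completeness of the modes concludes. *)
Lemma Q_tc_zero (n : Z) : (n1 <= n)%Z -> sig n = 0 -> Q (tc n) = zero.
Proof.
intros Hn Hsig.
assert (Hd : L2 (tc n) (Q (tc n)) = 0) by (pose proof (Q_skew (tc n) (tc n)); lra).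
unfold sig in Hsig.
apply fourier_unique; intros j; destruct (Z.eq_dec j n) as [->|Hj]; try assumption;
  destruct (Z.eq_dec j (- n)) as [->|Hj'].
- rewrite tc_opp; exact Hd.
- exact (proj2 (off_diagonal n j Hn Hj Hj')).
- rewrite ts_opp, L2_scal_l, Hsig; ring.
- exact (proj1 (off_diagonal n j Hn Hj Hj')).
Qed.

End LargeModes.

(** Here [u = m / al k], so the field is [3 / (2 al k)] times the derivative of
    [m ^ 2 = 1 - sin (2 k x)]: a nonzero multiple of a single mode when [k <> 0]. *)
Lemma euler_field_diagonal (k : Z) :
  euler_field Ainv (minus (tc k) (ts k)) = scal (- 3 * IZR k / al k) (tc (2 * k)).
Proof.
unfold euler_field, lie_poisson.
rewrite Ainv_minus, Ainv_tc, Ainv_ts, !cf_D_minus, !cf_D_scal, D_tc, D_ts.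
apply circle_fun_ext; intros x; cf_expand; unfold tc, ts; cbn [cfun].
rewrite mult_IZR, Rmult_assoc, cos_2a; field; apply al_neq_0.
Qed.

Lemma spectral_relation (dF : circle_fun -> circle_fun) :
  (forall m, euler_field Ainv m = Q (dF m)) ->
  exists n1 c1 c3, (c1 <> 0 \/ c3 <> 0) /\
    forall n, (n1 <= n)%Z ->
      (c1 + c3 * IZR n ^ 2) * al (2 * n) = (c1 + 4 * c3 * IZR n ^ 2) * al n.
Proof.
intros HX; destruct ell_separated as [n1 [Hn1 Hsep]].
destruct (sig_cubic n1 (sig_cocycle n1 Hn1 Hsep)) as [c1 [c3 Hs]].
exists n1, c1, c3; split.
- destruct (Req_dec c1 0) as [E1|E1]; [|now left].
  destruct (Req_dec c3 0) as [E3|E3]; [exfalso|now right].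
  assert (HQ : Q (tc (2 * n1)) = zero).
  { apply (Q_tc_zero n1 Hsep); [lia|]; rewrite Hs, E1, E3; ring. }
  (* Pairing [X_A = Q dF] with [tc (2 * n1)] moves [Q] onto a mode that it kills, while the Euler
     field has a nonzero component there. *)
  pose proof (Q_skew (tc (2 * n1)) (dF (minus (tc n1) (ts n1)))) as E.
  rewrite <- HX, euler_field_diagonal, HQ, L2_scal_r, L2_tc_tc in E by lia.
  replace (L2 (dF (minus (tc n1) (ts n1))) zero) with 0 in E.
  2:{ symmetry; transitivity (L2 (dF (minus (tc n1) (ts n1))) (scal 0 (tc 0))).
      - f_equal; apply circle_fun_ext; intros x; cf_expand; ring.
      - rewrite L2_scal_r; apply Rmult_0_l. }
  assert (H1 : 1 <= IZR n1) by (apply IZR_le; lia).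
  pose proof PI_RGT_0.
  assert (- 3 * IZR n1 / al n1 * PI <> 0); [|lra].
  apply Rmult_integral_contrapositive_currified; [|lra].
  apply Rmult_integral_contrapositive_currified; [lra|apply Rinv_neq_0_compat, al_neq_0].
- intros n Hn; pose proof (sig_hamiltonian n1 Hn1 Hsep n Hn) as E; rewrite !Hs, mult_IZR in E.
  assert (H1 : 1 <= IZR n) by (apply IZR_le; lia).
  apply (Rmult_eq_reg_l (2 * IZR n)); [|lra].
  transitivity (2 * (c1 * IZR n + c3 * IZR n ^ 3) * al (2 * n)); [ring|].
  rewrite E; ring.
Qed.

End Spectral.

(** The coefficient of [n ^ k] reads [c1 (2 ^ k - 1) e_k + c3 (2 ^ (k - 2) - 4) e_(k - 2) = 0]. If
    [c3 = 0] this kills every [e_k] with [k >= 1]. Otherwise it propagates zeros downwards, and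
    stops only where [2 ^ j - 4] vanishes, at [j = 2]. *)
Lemma pol_dilation_rigidity (N : nat) (e : nat -> R) (c1 c3 : R) (n1 : Z) :
  (forall k, (N < k)%nat -> e k = 0) -> c1 <> 0 \/ c3 <> 0 ->
  (forall n, (n1 <= n)%Z ->
    (c1 + c3 * IZR n ^ 2) * pol (2 + N) e (2 * IZR n) =
    (c1 + 4 * c3 * IZR n ^ 2) * pol (2 + N) e (IZR n)) ->
  forall k, k <> 0%nat -> k <> 2%nat -> e k = 0.
Proof.
intros He Hc H.
set (g := fun k => match k with S (S j) => (2 ^ j - 4) * e j | _ => 0 end).
assert (Hg : forall x, pol (2 + N) g x = x ^ 2 * (pol (2 + N) e (2 * x) - 4 * pol (2 + N) e x)).
{ intros x; simpl plus; rewrite !(pol_S (S N) g), (pol_S N); simpl.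
  assert (E : forall y, pol (S (S N)) e y = pol N e y).
  { intros y; apply (sum_n_support (fun k => e k * y ^ k) N); [|lia].
    intros k Hk; rewrite He by exact Hk; apply Rmult_0_l. }
  rewrite !E; clear.
  assert (P : pol N (fun k => (2 ^ k - 4) * e k) x = pol N e (2 * x) - 4 * pol N e x).
  { unfold pol; induction N as [|N IH]; [rewrite !sum_O; simpl; ring|].
    rewrite !sum_Sn, IH, Rpow_mult_distr; unfold plus; simpl; ring. }
  rewrite P; ring. }
set (h := fun k => c1 * (2 ^ k - 1) * e k + c3 * g k).
assert (Hh : forall x, pol (2 + N) h x =
  c1 * (pol (2 + N) e (2 * x) - pol (2 + N) e x) + c3 * pol (2 + N) g x).
{ intros x; unfold h, pol; generalize (2 + N)%nat as M; clear; induction M as [|M IH].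
  - rewrite !sum_O; simpl; ring.
  - rewrite !sum_Sn, IH, Rpow_mult_distr; unfold plus; simpl; ring. }
assert (Hz : forall k, h k = 0).
{ intros k; destruct (le_dec k (2 + N)) as [Hk|Hk].
  - revert k Hk; apply (pol_zero _ _ n1); intros n Hn.
    rewrite Hh, Hg; specialize (H n Hn); lra.
  - unfold h, g; destruct k as [|[|k]]; [lia|lia|]; rewrite !He by lia; ring. }
destruct (Req_dec c3 0) as [E3|E3].
- intros k Hk0 _; specialize (Hz k); unfold h in Hz; rewrite E3 in Hz.
  assert (1 < 2 ^ k) by (apply Rlt_pow_R1; [lra|lia]).
  apply (Rmult_eq_reg_l (c1 * (2 ^ k - 1))); [lra|].
  apply Rmult_integral_contrapositive_currified; [|lra].
  destruct Hc as [Hc|Hc]; [exact Hc|now contradict Hc].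
(* Descent on [k]: [i] bounds how far [k] may lie below [N + 1], and the induction hypothesis
   supplies [e (k + 2) = 0]. *)
- assert (D : forall i k, (N < k + i)%nat -> k <> 0%nat -> k <> 2%nat -> e k = 0).
  { induction i as [|i IH]; intros k Hki Hk0 Hk2; [apply He; lia|].
    specialize (Hz (S (S k))); unfold h in Hz; rewrite (IH (S (S k))) in Hz by lia.
    assert (Hp : 2 ^ k - 4 <> 0).
    { destruct k as [|[|[|k]]]; [lia|simpl; lra|lia|].
      assert (1 <= 2 ^ k) by (apply pow_R1_Rle; lra); simpl; lra. }
    apply (Rmult_eq_reg_l (c3 * (2 ^ k - 4))); [simpl in *; lra|].
    apply Rmult_integral_contrapositive_currified; assumption. }
  intros k; apply (D (S N) k); lia.
Qed.

Lemma bi_hamiltonian_aI_bD2 (A Ainv : circle_fun -> circle_fun) :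
  const_coeff_diff_operator A -> L2_symmetric A ->
  continuous_linear_iso A Ainv -> bi_hamiltonian_euler Ainv ->
  exists a b : R,
    (forall n : Z, a - b * IZR n ^ 2 <> 0) /\
    (forall u : circle_fun, A u = aI_bD2 a b u).
Proof.
intros Hconst Hsym Hiso [Q [F [HQ [dF [[_ [_ HF]] HX]]]]].
destruct (const_coeff_extend A Hconst) as [N [c [Hc HA]]].
pose proof Hiso as [_ [HI [HIA HAI]]]; pose proof HI as [Ip [Is _]].
set (e := fun k => c k * fst (ipow k)).
set (al := fun n : Z => pol (2 + N) e (IZR n)).
set (be := fun n : Z => pol (2 + N) (fun k => c k * snd (ipow k)) (IZR n)).
assert (HAt : forall n, A (tc n) = plus (scal (al n) (tc n)) (scal (- be n) (ts n)) /\
                        A (ts n) = plus (scal (al n) (ts n)) (scal (be n) (tc n))).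
{ intros n; rewrite !HA; apply const_coeff_trig. }
(* Symmetry tested on [tc n] and [ts n] gives [be n] times the sum of their squared norms equal to
   [0]. *)
assert (Hbe : forall n, be n = 0).
{ intros n; pose proof (Hsym (tc n) (ts n)) as E; destruct (HAt n) as [Ec Es].
  rewrite Ec, Es, L2_plus_l, L2_plus_r, !L2_scal_l, !L2_scal_r in E.
  pose proof (L2_tc_ts_sum n); pose proof PI_RGT_0.
  apply (Rmult_eq_reg_r (2 * PI)); [|lra]; rewrite <- H at 1; lra. }
assert (Hodd : forall k, c k * snd (ipow k) = 0).
{ intros k; destruct (le_dec k (2 + N)) as [Hk|Hk].
  - revert k Hk; apply (pol_zero _ _ 0); intros n _; apply Hbe.
  - rewrite Hc by lia; apply Rmult_0_l. }
assert (HAc : forall n, A (tc n) = scal (al n) (tc n)).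
{ intros n; rewrite (proj1 (HAt n)), Hbe; cf_ring. }
assert (HAs : forall n, A (ts n) = scal (al n) (ts n)).
{ intros n; rewrite (proj2 (HAt n)), Hbe; cf_ring. }
assert (Hal : forall n, al n <> 0).
{ intros n E; pose proof (HIA (tc n)) as H; rewrite HAc, E, Is in H.
  pose proof (f_equal (fun u : circle_fun => u 0) H) as H0; simpl in H0.
  rewrite Rmult_0_r, cos_0, Rmult_0_l in H0; lra. }
assert (HIe : forall n u, A u = scal (al n) u -> Ainv u = scal (/ al n) u).
{ intros n u E; rewrite <- (HIA u) at 2; rewrite E, Is.
  apply circle_fun_ext; intros x; cf_expand; field; apply Hal. }
assert (He : forall k, k <> 0%nat -> k <> 2%nat -> e k = 0).
(* The first alternative is the scalar case. The linear coefficient of [e] vanishes because [i] has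
   real part [0]. *)
{ destruct (pol_superlinear (2 + N) e) as [H|H]; [unfold e; simpl; ring| |].
  - intros k H0 _; destruct (le_dec k (2 + N)) as [Hk|Hk]; [apply H; lia|].
    unfold e; rewrite Hc by lia; apply Rmult_0_l.
  - destruct (spectral_relation Ainv Q al Hal) with (dF := dF) as [n1 [c1 [c3 [Hcc Hrel]]]].
    + intros u v; exact (cont_linear_minus (V := cf_NormedModuleAux) (W := cf_NormedModuleAux) Ainv u v HI).
    + exact Is.
    + intros n; apply HIe, HAc.
    + intros n; apply HIe, HAs.
    + intros M; destruct (H M) as [X HM]; exists X; intros n Hn; now apply HM.
    + exact HQ.
    + intros m v w; apply (hamiltonian_symmetry A Ainv Q F dF); auto; apply HQ.
    + exact HX.
    + apply (pol_dilation_rigidity N e c1 c3 n1); [|exact Hcc|].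
      * intros k Hk; unfold e; rewrite Hc by exact Hk; apply Rmult_0_l.
      * intros n Hn; specialize (Hrel n Hn); unfold al in Hrel; rewrite mult_IZR in Hrel; exact Hrel. }
assert (Hc02 : forall k, k <> 0%nat -> k <> 2%nat -> c k = 0).
(* As [i ^ k] has modulus [1], [c k] is recovered from its products with the real and imaginary
   parts, both of which vanish. *)
{ intros k H0 H2; pose proof (He k H0 H2) as E1; unfold e in E1; pose proof (Hodd k) as E2.
  pose proof (ipow_unit k) as E3.
  replace (c k) with (c k * (fst (ipow k) ^ 2 + snd (ipow k) ^ 2)) by (rewrite E3; ring).
  replace (c k * (fst (ipow k) ^ 2 + snd (ipow k) ^ 2))
    with (c k * fst (ipow k) * fst (ipow k) + c k * snd (ipow k) * snd (ipow k)) by ring.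
  rewrite E1, E2; ring. }
exists (c 0%nat), (c 2%nat); split.
- intros n; replace (c 0%nat - c 2%nat * IZR n ^ 2) with (al n); [apply Hal|].
  unfold al, pol; rewrite (sum_n_support _ 2); [|intros k Hk; rewrite He by lia; apply Rmult_0_l|lia].
  rewrite !sum_Sn, sum_O; unfold plus, e; simpl; ring.
- intros u; rewrite HA, (sum_n_support _ 2).
  + rewrite !sum_Sn, sum_O, (Hc02 1%nat) by lia; simpl; cf_ring.
  + intros k Hk; rewrite Hc02 by lia; apply circle_fun_ext; intros x; cf_expand; ring.
  + lia.
Qed.

Theorem theorem4p11 :
  (forall A Ainv : circle_fun -> circle_fun,
     const_coeff_diff_operator A -> L2_symmetric A ->
     continuous_linear_iso A Ainv ->
     bi_hamiltonian_euler Ainv ->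
     exists a b : R,
       (forall n : Z, a - b * IZR n ^ 2 <> 0) /\
       (forall u : circle_fun, A u = aI_bD2 a b u))
  /\
  (forall a b : R,
     (forall n : Z, a - b * IZR n ^ 2 <> 0) ->
     exists Ainv : circle_fun -> circle_fun,
       const_coeff_diff_operator (aI_bD2 a b) /\
       L2_symmetric (aI_bD2 a b) /\
       continuous_linear_iso (aI_bD2 a b) Ainv /\
       (forall u : circle_fun, cf_D (aI_bD2 a b u) = aD_bD3 a b u) /\
       second_hamiltonian (aD_bD3 a b) (H3 a b Ainv) (euler_field Ainv)).
Proof.
split; [exact bi_hamiltonian_aI_bD2|exact aI_bD2_bi_hamiltonian].
Qed.
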